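(* Let $X$ be a Banach space, let $Y$ be an Asplund space and let $G\in L(X,Y)$ be a norm-one operator. Then the following assertions are equivalent: (i) $G$ is lush. (ii) $G$ is a spear operator. (iii) $G$ has the alternative Daugavet property. (iv) $|x^{**}(G^*y^* )|=1$ for every $x^{**}\in\operatorname{ext}(B_{X^{**}})$ and every weak$^*$-denting point $y^*$ of $B_{Y^*}$. (v) The set $\{y^*\in\operatorname{ext}B_{Y^*}: G^*y^*\in\operatorname{Spear}(X^* )\}$ is dense in $(\operatorname{ext}B_{Y^*},w^* )$ or, equivalently, there is a dense subset $K$ of $(\operatorname{ext}B_{Y^*},w^* )$ such that $$B_X=\overline{\operatorname{aconv}}\bigl(\operatorname{Face}(S_X,G^*y^* )\bigr)$$ for every $y^*\in K$. (vi) $B_{Y^*}=\overline{\operatorname{conv}}^{w^*}\{y^*\in B_{Y^*}: G^*y^*\in\operatorname{Spear}(X^* )\}$.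
   Context: Scalars are $\mathbb{K}=\mathbb{R}$ or $\mathbb{C}$; $\mathbb{T}=\{\omega\in\mathbb{K}:|\omega|=1\}$; $B_X$, $S_X$ are the closed unit ball and unit sphere of $X$; $L(X,Y)$ is the space of bounded linear operators from $X$ to $Y$; $\operatorname{ext}$ denotes the set of extreme points; $\operatorname{aconv}(F)=\operatorname{conv}(\mathbb{T}F)$, and $\overline{\operatorname{aconv}}$ is its norm closure. For $A\subset X$ and $x^*\in X^*$ whose real part attains its supremum on $A$, $\operatorname{Face}(A,x^* )=\{x\in A:\operatorname{Re}x^*(x)=\sup_A\operatorname{Re}x^*\}$ (a non-empty set). $\operatorname{Spear}(Z)$ is the set of spear vectors of a Banach space $Z$: those $z\in S_Z$ with $\sup_{\omega\in\mathbb{T}}\|z+\omega x\|=1+\|x\|$ for every $x\in Z$. A norm-one $G\in L(X,Y)$ is a spear operator if $\sup_{\omega\in\mathbb{T}}\|G+\omega T\|=1+\|T\|$ for every $T\in L(X,Y)$; it has the alternative Daugavet property if this holds for every rank-one $T\in L(X,Y)$. A norm-one $G\in L(X,Y)$ is lush if for every $x_0\in B_X$, $\varepsilon>0$ and $y\in S_Y$ there is $F\subset B_X$ with $\operatorname{conv}(F)\subset\{x\in B_X:\|Gx+y\|>2-\varepsilon\}$ and $\operatorname{dist}(x_0,\operatorname{aconv}(F))<\varepsilon$. A point $y^*\in B_{Y^*}$ is weak$^*$-denting if it belongs to weak$^*$-open slices of $B_{Y^*}$ (slices defined by elements of $Y$) of arbitrarily small diameter.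
   Formalization: In the second form of (v), the condition ‖G*y*‖ = 1 for y* in K is added; without it the equivalence fails, e.g. X = K, Y = ℓ_∞^2, Gx = (x,0), where G*e_2* = 0 and Face(S_X,0) = S_X. *)

(* Defs.v *)
From HB Require Import structures.
From mathcomp Require Import all_boot all_order all_algebra.
From mathcomp Require Import complex.
From mathcomp Require Import all_classical all_reals all_analysis.
From mathcomp Require Import borel_hierarchy.

Set Implicit Arguments.
Unset Strict Implicit.
Unset Printing Implicit Defensive.

Import Order.TTheory GRing.Theory Num.Theory.
Import numFieldNormedType.Exports.

Local Open Scope classical_set_scope.
Local Open Scope ring_scope.

Inductive scalar_kind := RealScalars | ComplexScalars.

(* The scalar field, either R itself or its complexification R[i]. In MathComp
   the norm of a normed module over R[i] takes its values in R[i], where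
   x <= y means that y - x is a nonnegative real. *)
Definition scalars (R : realType) (k : scalar_kind) : numFieldType :=
  match k with
  | RealScalars => (R : numFieldType)
  | ComplexScalars => (R[i] : numFieldType)
  end.

Definition reK (R : realType) (k : scalar_kind) : scalars R k -> R :=
  match k with
  | RealScalars => fun z => z
  | ComplexScalars => @complex.Re R
  end.

Definition ofR (R : realType) (k : scalar_kind) : R -> scalars R k :=
  match k with
  | RealScalars => fun r => r
  | ComplexScalars => fun r => Complex r 0
  end.
Arguments ofR {R} k r.

Section scalar_theory.
Context {R : realType} {k : scalar_kind}.
Local Notation K := (scalars R k).
Implicit Types (r s : R) (z w : K).

Lemma ofRK : cancel (ofR k) (@reK R k).
Proof. by case: (k). Qed.

Lemma ofR0 : ofR k 0 = 0 :> K.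
Proof. by case: (k). Qed.

Lemma ofRD r s : ofR k (r + s) = ofR k r + ofR k s :> K.
Proof.
by case: (k) => //=; apply/eqP; rewrite eq_complex /= addr0 !eqxx.
Qed.

Lemma ofRM r s : ofR k (r * s) = ofR k r * ofR k s :> K.
Proof.
case: (k) => //=; apply/eqP; rewrite eq_complex /=.
by rewrite !(mulr0, mul0r) subr0 addr0 !eqxx.
Qed.

Lemma ler_ofR r s : (ofR k r <= ofR k s :> K) = (r <= s).
Proof. by case: (k) => //=; rewrite lecE /= eqxx. Qed.

Lemma reK_ge0 z : 0 <= z -> ofR k (reK z) = z.
Proof. by case: (k) z => //= -[a b]; rewrite lecE /= => /andP[/eqP -> _]. Qed.

End scalar_theory.

Definition rnorm (R : realType) (k : scalar_kind)
  (V : normedModType (scalars R k)) (x : V) : R := reK `|x|.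

Section rnorm_theory.
Context {R : realType} {k : scalar_kind} {V : normedModType (scalars R k)}.
Implicit Types x y : V.

Lemma rnormE x : ofR k (rnorm x) = `|x|.
Proof. exact: reK_ge0. Qed.

Lemma rnorm_ge0 x : 0 <= rnorm x.
Proof. by rewrite -(ler_ofR (k := k)) rnormE ofR0. Qed.

Lemma ler_rnormD x y : rnorm (x + y) <= rnorm x + rnorm y.
Proof. by rewrite -(ler_ofR (k := k)) ofRD !rnormE ler_normD. Qed.

Lemma rnormZ (a : scalars R k) x : rnorm (a *: x) = reK `|a| * rnorm x.
Proof.
apply: (can_inj (@ofRK R k)).
by rewrite ofRM !rnormE normrZ reK_ge0.
Qed.

End rnorm_theory.

Definition unit_ball (K : numDomainType) (V : normedModType K) : set V :=
  [set x | `|x| <= 1].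
Arguments unit_ball {K} V.

Definition unit_sphere (K : numDomainType) (V : normedModType K) : set V :=
  [set x | `|x| = 1].
Arguments unit_sphere {K} V.

Definition unit_scalars (K : numDomainType) : set K := [set w | `|w| = 1].
Arguments unit_scalars : clear implicits.

Section bounded_operators.
Context {R : realType} {k : scalar_kind}.
Local Notation K := (scalars R k).
Context {X Y : normedModType K}.

Definition bounded_linear : {pred X -> Y} := [pred f : X -> Y | `[<
  linear f /\ exists M : R, forall x, rnorm (f x) <= M * rnorm x >]].

Record blop := BLOp { blop_fun :> X -> Y; blopP : blop_fun \in bounded_linear }.

HB.instance Definition _ := [isSub for blop_fun].
HB.instance Definition _ := [Choice of blop by <:].

Fact bounded_linear_submod : submod_closed bounded_linear.
Proof.
split.
  apply/asboolP; split => [a x y|]; first by rewrite scaler0 addr0.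
  by exists 0 => x; rewrite mul0r /rnorm normr0 -(@ofR0 R k) ofRK.
move=> a f g /asboolP[lf [M Mf]] /asboolP[lg [N Ng]].
apply/asboolP; split => [b x y|].
  rewrite !fctE lf lg !scalerDr !scalerA (mulrC a b) -!addrA.
  by congr (_ + _); rewrite addrCA.
exists (reK `|a| * M + N) => x; rewrite !fctE mulrDl.
rewrite (le_trans (ler_rnormD _ _))// lerD// rnormZ -mulrA ler_wpM2l//.
by rewrite -(ler_ofR (k := k)) reK_ge0// ofR0.
Qed.

HB.instance Definition _ :=
  GRing.isSubmodClosed.Build K (X -> Y) bounded_linear bounded_linear_submod.
HB.instance Definition _ := [SubChoice_isSubLmodule of blop by <:].

Definition opnorm (f : blop) : R := sup [set rnorm (f x) | x in unit_ball X].


Fact blop_is_linear (f : blop) : linear f.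
Proof. by have /asboolP[] := blopP f. Qed.

Fact blop_bounded (f : blop) : exists M : R, forall x, rnorm (f x) <= M * rnorm x.
Proof. by have /asboolP[] := blopP f. Qed.

HB.instance Definition _ (f : blop) :=
  GRing.isLinear.Build K X Y _ (blop_fun f) (blop_is_linear f).

Lemma blopDE (f g : blop) x : (f + g) x = f x + g x. Proof. by []. Qed.

Lemma blopZE (a : K) (f : blop) x : (a *: f) x = a *: f x. Proof. by []. Qed.

Lemma unit_ball_rnorm x : unit_ball X x <-> rnorm x <= 1.
Proof.
by rewrite /unit_ball /= -rnormE -[X in _ <= X](@reK_ge0 R k)// ler_ofR (_ : reK 1 = 1)//; case: (k).
Qed.

Lemma opnorm_has_sup (f : blop) : has_sup [set rnorm (f x) | x in unit_ball X].
Proof.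
split; first by exists (rnorm (f 0)), 0 => //; rewrite /unit_ball /= normr0.
have [M Mf] := blop_bounded f; exists `|M| => _ [x /unit_ball_rnorm x1 <-].
rewrite (le_trans (Mf x))// (le_trans (ler_norm _))// normrM ler_piMr//.
by rewrite ger0_norm// rnorm_ge0.
Qed.

Lemma ler_opnorm (f : blop) x : rnorm x <= 1 -> rnorm (f x) <= opnorm f.
Proof.
move=> /unit_ball_rnorm x1; apply: ub_le_sup; last by exists x.
by have [] := opnorm_has_sup f.
Qed.

Lemma opnorm_le (f : blop) (M : R) :
  (forall x, rnorm x <= 1 -> rnorm (f x) <= M) -> opnorm f <= M.
Proof.
move=> fM; apply: ge_sup; first by have [] := opnorm_has_sup f.
by move=> _ [x /unit_ball_rnorm x1 <-]; exact: fM.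
Qed.

Lemma opnorm_ge0 (f : blop) : 0 <= opnorm f.
Proof.
rewrite (le_trans (rnorm_ge0 (f 0)))// ler_opnorm//.
by rewrite /rnorm normr0 -(@ofR0 R k) ofRK.
Qed.

Fact ler_opnormD (f g : blop) :
  ofR k (opnorm (f + g)) <= ofR k (opnorm f) + ofR k (opnorm g) :> K.
Proof.
rewrite -ofRD ler_ofR; apply: opnorm_le => x x1.
by rewrite (le_trans (ler_rnormD _ _))// lerD// ler_opnorm.
Qed.

Fact opnormZ (a : K) (f : blop) :
  ofR k (opnorm (a *: f)) = `|a| * ofR k (opnorm f).
Proof.
have leZ b g : opnorm (b *: g) <= reK `|b| * opnorm g.
  apply: opnorm_le => x x1; rewrite blopZE rnormZ ler_wpM2l ?ler_opnorm//.
  by rewrite -(ler_ofR (k := k)) reK_ge0// ofR0.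
rewrite -[X in X * _](@reK_ge0 R k)// -ofRM; congr (ofR k _).
apply/eqP; rewrite eq_le leZ /=.
have [->|a0] := eqVneq a 0.
  by rewrite normr0 -(@ofR0 R k) ofRK mul0r opnorm_ge0.
have := leZ a^-1 (a *: f); rewrite scalerA mulVf// scale1r.
have ra : 0 <= reK `|a| by rewrite -(ler_ofR (k := k)) reK_ge0// ofR0.
move=> /(ler_wpM2l ra); rewrite mulrA.
suff -> : reK `|a| * reK `|a^-1| = 1 by rewrite mul1r.
apply: (can_inj (@ofRK R k)); rewrite ofRM !reK_ge0// -normrM mulfV// normr1.
by case: (k).
Qed.

Fact opnorm_eq0 (f : blop) : ofR k (opnorm f) = 0 -> f = 0.
Proof.
rewrite -(@ofR0 R k) => /(can_inj (@ofRK R k)) f0.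
apply/val_inj/funext => x /=; apply/eqP.
have [->|x0] := eqVneq x 0; first by rewrite linear0.
have nx0 : `|x| != 0 by rewrite normr_eq0.
rewrite -normr_eq0; have := @ler_opnorm f (`|x|^-1 *: x).
rewrite f0 linearZ !rnormZ normfV normr_id => fx.
have rx : reK `|x|^-1 * rnorm x = 1.
  apply: (can_inj (@ofRK R k)).
  by rewrite ofRM rnormE reK_ge0// ?invr_ge0// mulVf//; case: (k).
have {fx} := fx; rewrite rx => /(_ (lexx _)).
rewrite -(ler_ofR (k := k)) ofRM ofR0 rnormE reK_ge0 ?invr_ge0//.
by rewrite pmulr_rle0 ?normr_le0 ?normr_eq0// invr_gt0 normr_gt0.
Qed.

HB.instance Definition _ := Lmodule_isNormed.Build K blop
  ler_opnormD opnormZ opnorm_eq0.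

Lemma blop_normE (f : blop) : `|f| = ofR k (opnorm f). Proof. by []. Qed.

End bounded_operators.
Arguments blop {R k} X Y.


Definition dual (R : realType) (k : scalar_kind)
  (X : normedModType (scalars R k)) : normedModType (scalars R k) :=
  blop X (scalars R k)^o.

Fact adjoint_subproof (R : realType) (k : scalar_kind)
    (X Y : normedModType (scalars R k)) (G : blop X Y) (f : dual Y) :
  (fun x => blop_fun f (G x)) \in bounded_linear (X := X) (Y := (scalars R k)^o).
Proof.
apply/asboolP; split=> [a x y|]; first by rewrite !linearP.
have [[M Mf] [N NG]] := (blop_bounded f, blop_bounded G).
exists (`|M| * N) => x; rewrite (le_trans (Mf _))// -mulrA.
by rewrite (le_trans (ler_wpM2r _ (ler_norm M)))// ?rnorm_ge0// ler_wpM2l.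
Qed.

Definition adjoint (R : realType) (k : scalar_kind)
    (X Y : normedModType (scalars R k)) (G : blop X Y) (f : dual Y) : dual X :=
  BLOp (adjoint_subproof G f).

Section geometry.
Context {R : realType} {k : scalar_kind}.
Local Notation K := (scalars R k).

(* convex_set takes its weights in K; those lying between 0 and 1 are real. *)
Definition conv_hull (V : normedModType K) (A : set V) : set V :=
  smallest (@convex_set K V) A.

Definition aconv (V : normedModType K) (A : set V) : set V :=
  conv_hull [set w *: x | w in unit_scalars K & x in A].

Definition ext (V : normedModType K) (C : set V) : set V :=
  [set x | C x /\ forall (y z : V) (t : R), C y -> C z -> 0 < t < 1 ->
     x = ofR k t *: y + ofR k (1 - t) *: z -> y = x /\ z = x].

Definition Face (V : normedModType K) (A : set V) (f : dual V) : set V :=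
  [set x | A x /\ reK (f x) = sup [set reK (f z) | z in A]].

Definition Spear (Z : normedModType K) : set Z :=
  [set z | `|z| = 1 /\ forall x : Z,
     sup [set rnorm (z + w *: x) | w in unit_scalars K] = 1 + rnorm x].

Definition weak_star (V : normedModType K) : topologicalType :=
  initial_topology (fun f : dual V => (blop_fun f : {ptws V -> K^o})).

Definition wclosure (V : normedModType K) (A : set (dual V)) : set (dual V) :=
  @closure (weak_star V) A.

Definition wdense_in (V : normedModType K) (A B : set (dual V)) : Prop :=
  A `<=` B /\ B `<=` wclosure A.

Definition wslice (V : normedModType K) (y : V) (a : R) : set (dual V) :=
  [set f | unit_ball (dual V) f /\
     sup [set reK (blop_fun g y) | g in unit_ball (dual V)] - a < reK (f y)].

Definition wdenting (V : normedModType K) : set (dual V) :=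
  [set f | unit_ball (dual V) f /\ forall e : R, 0 < e ->
     exists (y : V) (a : R), [/\ 0 < a, wslice y a f &
       forall g h, wslice y a g -> wslice y a h -> rnorm (g - h) <= e]].

(* Over R[i] a real-valued function is differentiated as a function on the
   underlying real normed space. *)
Definition frechet_differentiable (V : normedModType K) (f : V -> R) (x : V) :=
  exists D : V -> R,
    [/\ forall (r : R) u v, D (ofR k r *: u + v) = r * D u + D v,
        exists M : R, forall h, `|D h| <= M * rnorm h &
        forall e : R, 0 < e -> exists2 d : R, 0 < d &
          forall h, rnorm h < d -> `|f (x + h) - f x - D h| <= e * rnorm h].

Definition convex_on (V : normedModType K) (U : set V) (f : V -> R) :=
  forall (x y : V) (t : R), U x -> U y -> 0 <= t <= 1 ->
    f (ofR k t *: x + ofR k (1 - t) *: y) <= t * f x + (1 - t) * f y.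

Definition asplund (V : completeNormedModType K) : Prop :=
  forall (U : set V) (f : V -> R),
    open U -> U !=set0 -> convex_set (U : set (convex_lmodType V)) ->
    convex_on U f -> (forall x, U x -> {for x, continuous f}) ->
    exists D : set V, [/\ Gdelta D, D `<=` U, U `<=` closure D &
      forall x, D x -> frechet_differentiable f x].

Variables X Y : normedModType K.

Definition rank_one (T : blop X Y) : Prop :=
  exists2 y : Y, y != 0 & range T = [set a *: y | a in [set: K]].

Definition lush (G : blop X Y) : Prop :=
  `|G| = 1 /\ forall (x0 : X) (e : R) (y : Y),
    unit_ball X x0 -> 0 < e -> unit_sphere Y y ->
    exists F : set X, [/\ F `<=` unit_ball X,
      conv_hull F `<=` [set x | unit_ball X x /\ 2 - e < rnorm (G x + y)] &
      exists2 z : X, aconv F z & rnorm (x0 - z) < e].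

Definition spear_operator (G : blop X Y) : Prop :=
  `|G| = 1 /\ forall T : blop X Y,
    sup [set rnorm (G + w *: T) | w in unit_scalars K] = 1 + rnorm T.

Definition alternative_daugavet (G : blop X Y) : Prop :=
  `|G| = 1 /\ forall T : blop X Y, rank_one T ->
    sup [set rnorm (G + w *: T) | w in unit_scalars K] = 1 + rnorm T.

End geometry.
Arguments Spear {R k} Z.
Arguments wdenting {R k} V.

(* Main.v *)
(** All supporting functionals come from one form of the Hahn-Banach theorem: a
    sublinear functional p dominates a linear functional that is extreme among
    those it dominates. It yields norming extreme points of dual balls, a
    bipolar theorem for the weak* topology and Choquet's lemma (weak* slices are
    a neighbourhood base at extreme points) without any compactness argument.

    A vector z is a spear iff |e z| = 1 at every extreme point e of the dual
    ball: by Choquet's lemma in one direction, by norming extreme points in the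
    other. For a spear z of X^*, separation shows that the absolutely convex hull
    of the points of B_X at which z is nearly 1 is dense in B_X; moving such a
    point into ever thinner slices and passing to the limit, in a complete X, one
    may replace the slices by the face.

    The Asplund property of Y is used only for its norm: a Frechet derivative of
    the norm at y is a weak*-denting point norming y, so by Choquet's lemma the
    denting points are weak*-dense among the extreme points. The alternative
    Daugavet property, tested on x^* (x) y with y defining a small slice around a
    denting point y^*, gives sup_w ||G^* y^* + w x^*|| = 1 + ||x^*||, that is,
    G^* y^* is a spear. *)

Require Import Defs.
From mathcomp Require Import all_boot all_order all_algebra.
From mathcomp Require Import complex.
From mathcomp Require Import all_classical all_reals all_analysis.
From mathcomp Require Import ring lra.

Import Order.TTheory GRing.Theory Num.Theory.
Import numFieldNormedType.Exports.
Local Open Scope classical_set_scope.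
Local Open Scope ring_scope.

Set Implicit Arguments.
Unset Strict Implicit.
Unset Printing Implicit Defensive.

(* The imaginary unit, or 0 over the reals: in both cases
   |z| <= |Re z| + |Re (imK * z)|. *)
Definition imK (R : realType) (k : scalar_kind) : scalars R k :=
  match k with
  | RealScalars => 0
  | ComplexScalars => Complex 0 1
  end.

(** * Real parts, moduli and unimodular scalars, uniformly in both fields *)

Section scalars.
Context {R : realType} {k : scalar_kind}.
Local Notation K := (scalars R k).
Implicit Types (r s t : R) (z w : K).

Lemma reKD z w : reK (z + w) = reK z + reK w.
Proof. by case: (k) z w => //= -[a b] [c d]. Qed.

Lemma reKN z : reK (- z) = - reK z.
Proof. by case: (k) z => //= -[a b]. Qed.

Lemma reKB z w : reK (z - w) = reK z - reK w.
Proof. by rewrite reKD reKN. Qed.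

Lemma reK0 : reK (0 : K) = 0.
Proof. by case: (k). Qed.

Lemma reK1 : reK (1 : K) = 1.
Proof. by case: (k). Qed.

Lemma reKZ r z : reK (ofR k r * z) = r * reK z.
Proof. by case: (k) z => //= -[a b] /=; rewrite mul0r subr0. Qed.

Lemma ofR1 : ofR k 1 = 1 :> K.
Proof. by case: (k). Qed.

Lemma ofRN r : ofR k (- r) = - ofR k r :> K.
Proof.
by apply/eqP; rewrite -subr_eq0 opprK -ofRD addNr ofR0.
Qed.

Lemma ofRB r s : ofR k (r - s) = ofR k r - ofR k s :> K.
Proof. by rewrite ofRD ofRN. Qed.

Lemma ltr_ofR r s : (ofR k r < ofR k s :> K) = (r < s).
Proof. by rewrite !lt_neqAle ler_ofR (inj_eq (can_inj (@ofRK R k))). Qed.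

Lemma normK_ofR r : `|ofR k r| = ofR k `|r|.
Proof.
have [r0|r0] := leP 0 r.
  by rewrite !ger0_norm// -ofR0 ler_ofR.
by rewrite !ltr0_norm ?ofRN// -ofR0 ltr_ofR.
Qed.

Lemma rnorm_ofR r : rnorm (ofR k r : K^o) = `|r|.
Proof. by rewrite /rnorm normK_ofR ofRK. Qed.

Lemma ler_reK_norm z : reK z <= rnorm (z : K^o).
Proof.
rewrite -(ler_ofR (k := k)) rnormE; case: (k) z => [z|[a b]] /=.
  exact: ler_norm.
rewrite normc_def lecR (le_trans (ler_norm _))// -sqrtr_sqr.
by rewrite ler_wsqrtr// lerDl sqr_ge0.
Qed.

Lemma ler_norm_reK z : `|reK z| <= rnorm (z : K^o).
Proof.
rewrite ler_norml ler_reK_norm andbT lerNl -reKN.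
by rewrite (le_trans (ler_reK_norm _))// /rnorm normrN.
Qed.

(** Lets weak* neighbourhoods be tested on real parts alone. *)
Lemma ler_rnorm_reK z : rnorm (z : K^o) <= `|reK z| + `|reK (imK R k * z)|.
Proof.
rewrite -(ler_ofR (k := k)) rnormE; case: (k) z => [z|[a b]] /=.
  by rewrite lerDl.
rewrite normc_def lecR mul0r mul1r sub0r normrN -[leRHS]ger0_norm ?addr_ge0//.
rewrite -sqrtr_sqr ler_wsqrtr//= -(real_normK (num_real a)).
by rewrite -(real_normK (num_real b)) sqrrD addrAC lerDl mulrn_wge0 ?mulr_ge0.
Qed.

Lemma rotate z : exists2 w, unit_scalars K w & w * z = ofR k (rnorm (z : K^o)).
Proof.
rewrite rnormE; have [->|z0] := eqVneq z 0.
  by exists 1; rewrite /unit_scalars/= ?normr1// normr0 mulr0.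
have nz0 : `|z| != 0 by rewrite normr_eq0.
exists (`|z| / z); last by rewrite divfK.
by rewrite /unit_scalars/= normf_div normr_id divff.
Qed.

Lemma unit_scalars1 : unit_scalars K 1.
Proof. by rewrite /unit_scalars/= normr1. Qed.

Lemma unit_scalarsM w z :
  unit_scalars K w -> unit_scalars K z -> unit_scalars K (w * z).
Proof. by rewrite /unit_scalars/= normrM => -> ->; rewrite mulr1. Qed.

Lemma unit_scalarsV w : unit_scalars K w -> unit_scalars K w^-1.
Proof. by rewrite /unit_scalars/= normfV => ->; rewrite invr1. Qed.

Lemma unit_scalars_neq0 w : unit_scalars K w -> w != 0.
Proof. by rewrite -normr_eq0 => ->; rewrite oner_neq0. Qed.

(** Converts a real part near 1 into a small distance to 1. *)
Lemma unit_scalars_dist w : unit_scalars K w ->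
  rnorm ((1 - w) : K^o) ^+ 2 = 2 * (1 - reK w).
Proof.
rewrite /unit_scalars /rnorm/=; case: (k) w => [w|[a b]] /=.
  move=> /= w1; rewrite real_normK ?num_real//.
  have w2 : w ^+ 2 = 1 by rewrite -(real_normK (num_real w)) w1 expr1n.
  by rewrite sqrrB expr1n w2; lra.
rewrite normc_def => -[] w1.
have w2 : a ^+ 2 + b ^+ 2 = 1.
  by rewrite -[LHS]sqr_sqrtr ?w1 ?expr1n// addr_ge0 ?sqr_ge0.
by rewrite sqr_sqrtr ?addr_ge0 ?sqr_ge0//=; move: w2; rewrite !expr2; lra.
Qed.

End scalars.

(** * The real-valued norm and its topology *)

Section rnorm.
Context {R : realType} {k : scalar_kind} {V : normedModType (scalars R k)}.
Local Notation K := (scalars R k).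
Implicit Types (x y : V) (r : R).

Lemma rnorm0 : rnorm (0 : V) = 0.
Proof. by rewrite /rnorm normr0 reK0. Qed.

Lemma rnormN x : rnorm (- x) = rnorm x.
Proof. by rewrite /rnorm normrN. Qed.

Lemma rnorm_distC x y : rnorm (x - y) = rnorm (y - x).
Proof. by rewrite /rnorm distrC. Qed.

Lemma ler_rnormB x y : rnorm (x - y) <= rnorm x + rnorm y.
Proof. by rewrite -[rnorm y]rnormN ler_rnormD. Qed.

Lemma ler_rnorm_dist x y z : rnorm (x - z) <= rnorm (x - y) + rnorm (y - z).
Proof. by rewrite (le_trans _ (ler_rnormD _ _))// addrA subrK. Qed.

Lemma lerB_rnorm x y : rnorm x - rnorm y <= rnorm (x - y).
Proof. by rewrite lerBlDr (le_trans _ (ler_rnormD _ _))// subrK. Qed.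

Lemma rnorm_eq0 x : rnorm x = 0 -> x = 0.
Proof. by move=> x0; apply/eqP; rewrite -normr_eq0 -rnormE x0 ofR0. Qed.

Lemma rnorm_gt0 x : x != 0 -> 0 < rnorm x.
Proof.
move=> x0; rewrite lt_neqAle rnorm_ge0 andbT.
by apply: contra x0 => /eqP/esym/rnorm_eq0/eqP.
Qed.

Lemma rnormZofR r x : rnorm (ofR k r *: x) = `|r| * rnorm x.
Proof. by rewrite rnormZ normK_ofR ofRK. Qed.

Lemma rnormZ_unit w x : unit_scalars K w -> rnorm (w *: x) = rnorm x.
Proof. by move=> w1; rewrite rnormZ w1 reK1 mul1r. Qed.

Lemma rnorm1P x : (`|x| = 1) <-> (rnorm x = 1).
Proof.
rewrite -rnormE; split => [|->]; last by rewrite ofR1.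
by rewrite -ofR1 => /(can_inj (@ofRK R k)).
Qed.

Lemma normalize x : x != 0 -> rnorm (ofR k (rnorm x)^-1 *: x) = 1.
Proof.
move=> /rnorm_gt0 x0; rewrite rnormZofR ger0_norm ?invr_ge0 ?rnorm_ge0//.
by rewrite mulVf// gt_eqF.
Qed.

(** Balls have radii in [K], but a positive element of [K] is real, so radii in [R] suffice. *)
Lemma nbhs_rnormP x (A : set V) :
  nbhs x A <-> exists2 e : R, 0 < e & forall y, rnorm (x - y) < e -> A y.
Proof.
split=> [/nbhs_ballP[e /= e0 xA]|[e e0 xA]].
  exists (reK e); first by rewrite -(ltr_ofR (k := k)) ofR0 reK_ge0// ltW.
  move=> y; rewrite -(ltr_ofR (k := k)) rnormE reK_ge0 ?ltW// => xy.
  by apply: xA; rewrite -ball_normE.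
apply/nbhs_ballP; exists (ofR k e); first by rewrite /= -ofR0 ltr_ofR.
by move=> y; rewrite -ball_normE /= -rnormE ltr_ofR => /xA.
Qed.

Lemma closure_rnormP (A : set V) x :
  closure A x <-> forall e : R, 0 < e -> exists2 a, A a & rnorm (x - a) < e.
Proof.
split=> [xA e e0|xA B /nbhs_rnormP[e e0 eB]].
  have /xA[a [Aa xa]] : nbhs x [set y | rnorm (x - y) < e].
    by apply/nbhs_rnormP; exists e.
  by exists a.
by have [a Aa xa] := xA _ e0; exists a; split => //; exact: eB.
Qed.

End rnorm.

(** * Functionals and their real parts *)

Section dual.
Context {R : realType} {k : scalar_kind}.
Local Notation K := (scalars R k).

Definition real_linear (V : lmodType K) (u : V -> R) :=
  (forall x y, u (x + y) = u x + u y) /\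
  (forall r x, u (ofR k r *: x) = r * u x).

Section real_linear.
Variables (V : lmodType K) (u : V -> R) (lu : real_linear u).

Lemma real_linearN x : u (- x) = - u x.
Proof. by have [_ /(_ (-1) x)] := lu; rewrite ofRN ofR1 scaleN1r mulN1r. Qed.

Lemma real_linearB x y : u (x - y) = u x - u y.
Proof. by rewrite lu.1 real_linearN. Qed.

Lemma real_linear0 : u 0 = 0.
Proof. by rewrite -(subrr 0) real_linearB subrr. Qed.

End real_linear.

Lemma ler_rnorm_blop (V W : normedModType K) (T : blop V W) x :
  rnorm (T x) <= rnorm T * rnorm x.
Proof.
have [->|x0] := eqVneq x 0; first by rewrite linear0 !rnorm0 mulr0.
have := ler_opnorm T (_ : rnorm (ofR k (rnorm x)^-1 *: x) <= 1).
rewrite normalize// => /(_ (lexx _)).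
rewrite linearZ/= rnormZofR ger0_norm ?invr_ge0 ?rnorm_ge0//.
rewrite mulrC ler_pdivrMr ?rnorm_gt0// => /le_trans; apply.
by rewrite ler_wpM2r ?rnorm_ge0// -(ler_ofR (k := k)) rnormE.
Qed.

Section dual_space.
Context {V : normedModType K}.
Implicit Types (f g : dual V) (x y : V).

Lemma dualE f x : rnorm (f x : K^o) <= rnorm f * rnorm x.
Proof. exact: ler_rnorm_blop. Qed.

Lemma ler_dual f x : reK (f x) <= rnorm f * rnorm x.
Proof. exact: le_trans (ler_reK_norm _) (dualE _ _). Qed.

Lemma dual_ball f x : rnorm f <= 1 -> reK (f x) <= rnorm x.
Proof.
by move=> f1; rewrite (le_trans (ler_dual f x))// ler_piMl// rnorm_ge0.
Qed.

Lemma dual_ball_norm f x : rnorm f <= 1 -> rnorm (f x : K^o) <= rnorm x.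
Proof.
by move=> f1; rewrite (le_trans (dualE f x))// ler_piMl// rnorm_ge0.
Qed.

Lemma dual_real_linear f : real_linear (fun x => reK (f x)).
Proof.
split=> [x y|r x]; first by rewrite linearD reKD.
by rewrite linearZ /= reKZ.
Qed.

Lemma reK_dualD f x y : reK (f (x + y)) = reK (f x) + reK (f y).
Proof. exact: (dual_real_linear f).1. Qed.

Lemma reK_dualB f x y : reK (f (x - y)) = reK (f x) - reK (f y).
Proof. exact: real_linearB (dual_real_linear f) _ _. Qed.

Lemma dualZ f (a : K) x : f (a *: x) = a * f x :> K.
Proof. by rewrite linearZ. Qed.

(** Rotating x makes f x a nonnegative real and keeps the norm of x, so real parts determine the
    dual norm. *)
Lemma dual_rnorm_le f (M : R) :
  (forall x, rnorm x <= 1 -> reK (f x) <= M) -> rnorm f <= M.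
Proof.
move=> fM; rewrite /rnorm blop_normE ofRK; apply: opnorm_le => x x1.
have [w w1 wfx] := rotate (f x).
by rewrite -(@ofRK R k (rnorm _)) -wfx -[w * _]linearZ fM// rnormZ_unit.
Qed.

Lemma dual_reK_eq f g : (forall x, reK (f x) = reK (g x)) -> f = g.
Proof.
move=> fg; apply/eqP; rewrite -subr_eq0; apply/eqP/rnorm_eq0/eqP.
rewrite eq_le rnorm_ge0 andbT; apply: dual_rnorm_le => x _.
by rewrite [(f - g) x](_ : _ = f x - g x)// reKB fg subrr.
Qed.

Lemma dual_rnorm_gt f (r : R) : r < rnorm f ->
  exists2 x, rnorm x <= 1 & r < reK (f x).
Proof.
move=> rf; apply: contrapT => /forall2NP nx.
have : rnorm f <= r; last by rewrite leNgt rf.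
by apply: dual_rnorm_le => x x1; have [] // := nx x; move/negP; rewrite -leNgt.
Qed.

End dual_space.

End dual.

(* A complex-linear functional is determined by its real part u,
   through f x = u x - i u (i x). *)
Lemma complexify (R : realType) (k : scalar_kind) (V : lmodType (scalars R k))
  (u : V -> R) : real_linear u ->
  exists2 f : V -> (scalars R k)^o, linear f & forall x, reK (f x) = u x.
Proof.
case: k V u => [V u [uD uZ]|V u lu].
  by exists u => // a x y; rewrite uD (uZ a).
have [uD uZ] := lu; have uN := real_linearN lu.
pose i : R[i] := Complex 0 1.
exists (fun x => Complex (u x) (- u (i *: x))) => // -[a b] x y.
have e z : Complex a b *: z = ofR ComplexScalars a *: z +
    ofR ComplexScalars b *: (i *: z) :> V.
  rewrite scalerA -scalerDl; congr (_ *: z).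
  by apply/eqP; rewrite eq_complex /=; apply/andP; split; apply/eqP; ring.
have ii : i *: (i *: x) = - x.
  rewrite scalerA -scaleN1r; congr (_ *: x).
  by apply/eqP; rewrite eq_complex /=; apply/andP; split; apply/eqP; ring.
have ix : i *: (Complex a b *: x) = Complex a b *: (i *: x).
  by rewrite !scalerA mulrC.
rewrite scalerDr ix !uD !e !uD !uZ ii uN.
by apply/eqP; rewrite eq_complex /=; apply/andP; split; apply/eqP; ring.
Qed.

(** Rotating x upgrades the one-sided bound on u to a bound on the modulus of f. *)
Lemma dual_of_real (R : realType) (k : scalar_kind)
  (V : normedModType (scalars R k)) (u : V -> R) (M : R) : 0 <= M ->
  real_linear u -> (forall x, u x <= M * rnorm x) ->
  exists2 f : dual V, rnorm f <= M & forall x, reK (f x) = u x.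
Proof.
move=> M0 lu uM; have [f lf fu] := complexify lu.
have fM x : rnorm (f x) <= M * rnorm x.
  have [w w1 wfx] := rotate (f x).
  have f0 : f 0 = 0 by have := lf (-1) 0 0; rewrite !scaleN1r oppr0 addr0 addNr.
  have lfZ a y : f (a *: y) = a *: f y.
    by have := lf a y 0; rewrite addr0 f0 addr0.
  rewrite -(@ofRK R k (rnorm (f x))) -wfx -[w * _]lfZ fu (le_trans (uM _))//.
  by rewrite rnormZ_unit.
have fP : f \in bounded_linear by apply/asboolP; split => //; exists M.
exists (BLOp fP) => //; apply: dual_rnorm_le => x x1 /=.
by rewrite fu (le_trans (uM x))// ler_piMr.
Qed.

(** * The Hahn-Banach theorem with extremal functionals *)

Section hahn_banach.
Context {R : realType} {k : scalar_kind}.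
Local Notation K := (scalars R k).
Context {V : lmodType K}.
Implicit Types (p q u f g : V -> R) (x y v : V) (r s t : R).

Definition sublinear p :=
  (forall x y, p (x + y) <= p x + p y) /\
  (forall r x, 0 <= r -> p (ofR k r *: x) = r * p x).

Lemma sublinear_intro p : p 0 = 0 ->
  (forall x y, p (x + y) <= p x + p y) ->
  (forall r x, 0 < r -> p (ofR k r *: x) <= r * p x) -> sublinear p.
Proof.
move=> p0 pD pZ; split=> // r x; rewrite le_eqVlt => /predU1P[<-|r0].
  by rewrite ofR0 scale0r mul0r.
apply/eqP; rewrite eq_le pZ//= -ler_pdivlMl//.
rewrite -{1}(scale1r x) -(ofR1 (k := k)) -(mulVf (lt0r_neq0 r0)) ofRM -scalerA.
by rewrite pZ// invr_gt0.
Qed.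

Lemma sublinear0 p : sublinear p -> p 0 = 0.
Proof. by case=> _ /(_ 0 0 (lexx _)); rewrite scaler0 mul0r. Qed.

Lemma sublinearN p x : sublinear p -> - p (- x) <= p x.
Proof.
move=> lp; rewrite lerNl -subr_ge0 opprK -(sublinear0 lp).
by rewrite -(subrr x) addrC lp.1.
Qed.

Lemma sublinear_real_linear p : sublinear p ->
  (forall x y, p x + p y <= p (x + y)) -> real_linear p.
Proof.
move=> lp pD; have pDE x y : p (x + y) = p x + p y.
  by apply/eqP; rewrite eq_le lp.1 pD.
have pN x : p (- x) = - p x.
  by apply/eqP; rewrite -addr_eq0 -pDE addNr sublinear0.
split=> // r x; have [r0|r0] := leP 0 r; first exact: lp.2.
rewrite -[r]opprK ofRN scaleNr pN lp.2 ?mulNr//.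
by rewrite oppr_ge0 ltW.
Qed.

Lemma real_linear_le f g : real_linear f -> real_linear g ->
  (forall x, f x <= g x) -> f = g.
Proof.
move=> lf lg fg; apply/funext => x; apply/eqP; rewrite eq_le fg /=.
by have := fg (- x); rewrite !real_linearN// lerN2.
Qed.

Section cone.
Variables (p : V -> R) (S : set (V * R)).
Hypotheses (lp : sublinear p) (S0 : S !=set0)
  (SD : forall a b, S a -> S b -> S (a.1 + b.1, a.2 + b.2))
  (SZ : forall r a, 0 <= r -> S a -> S (ofR k r *: a.1, r * a.2))
  (Sp : forall a, S a -> a.2 <= p a.1).

(** S is a cone of constraints (a, s), each demanding s <= u a. A linear u lies below [cone_inf]
    exactly when u <= p and u meets all of them. *)
Definition cone_inf x := inf [set p (x + a.1) - a.2 | a in S].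

Let lbS x a : S a -> - p (- x) <= p (x + a.1) - a.2.
Proof.
move=> Sa; have := lp.1 (- x) (x + a.1); rewrite addKr.
by have := Sp Sa; lra.
Qed.

Let infS x : has_inf [set p (x + a.1) - a.2 | a in S].
Proof.
split; first by have [a Sa] := S0; exists (p (x + a.1) - a.2), a.
by exists (- p (- x)) => _ [a Sa <-]; exact: lbS.
Qed.

Lemma cone_inf_le x a : S a -> cone_inf x <= p (x + a.1) - a.2.
Proof. by move=> Sa; apply: ge_inf; [exact: (infS x).2|exists a]. Qed.

Lemma le_cone_inf x r : (forall a, S a -> r <= p (x + a.1) - a.2) ->
  r <= cone_inf x.
Proof.
by move=> rS; apply: lb_le_inf; [exact: (infS x).1|move=> _ [a Sa <-]; exact: rS].
Qed.

Lemma cone_inf_lep x : cone_inf x <= p x.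
Proof.
have [a Sa] := S0; have := cone_inf_le x (SZ (lexx 0) Sa).
by rewrite /= ofR0 scale0r mul0r addr0 subr0.
Qed.

Lemma cone_inf_sublinear : sublinear cone_inf.
Proof.
apply: sublinear_intro => [|x y|r x r0].
- apply/eqP; rewrite eq_le (le_trans (cone_inf_lep _)) ?(sublinear0 lp)//=.
  apply: le_cone_inf => a /(lbS 0); rewrite oppr0 sublinear0// oppr0.
  by [].
- rewrite -lerBlDr; apply: le_cone_inf => a Sa.
  rewrite lerBlDr [leRHS]addrC -lerBlDr.
  apply: le_cone_inf => b Sb; rewrite lerBlDr.
  apply: (le_trans (cone_inf_le _ (SD Sa Sb))) => /=.
  by rewrite addrACA; have := lp.1 (x + a.1) (y + b.1); lra.
- rewrite -ler_pdivrMl//; apply: le_cone_inf => a Sa.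
  rewrite ler_pdivrMl//; apply: (le_trans (cone_inf_le _ (SZ (ltW r0) Sa))).
  by rewrite /= -scalerDr lp.2 ?(ltW r0)// mulrBr.
Qed.

(** Evaluation at [- a.1] reduces the p-term to p 0 = 0. *)
Lemma cone_inf_linear u : real_linear u -> (forall x, u x <= cone_inf x) ->
  forall a, S a -> a.2 <= u a.1.
Proof.
move=> lu up a Sa; have := up (- a.1).
have := cone_inf_le (- a.1) Sa; rewrite addNr sublinear0// (real_linearN lu).
lra.
Qed.

End cone.

(** The cone generated by the single constraint s <= u x; for s = p x it describes the face u x = p
    x of {u <= p}. *)
Definition ray x s : set (V * R) :=
  [set (ofR k t *: x, t * s) | t in [set t | 0 <= t]].

Lemma ray0 x s : ray x s !=set0.
Proof. by exists (ofR k 0 *: x, 0 * s), 0 => /=. Qed.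

Lemma rayD x s a b : ray x s a -> ray x s b -> ray x s (a.1 + b.1, a.2 + b.2).
Proof.
move=> [t /= t0 <-] [t' /= t'0 <-] /=; exists (t + t'); first exact: addr_ge0.
by rewrite ofRD scalerDl mulrDl.
Qed.

Lemma rayZ x s r a : 0 <= r -> ray x s a -> ray x s (ofR k r *: a.1, r * a.2).
Proof.
move=> r0 [t /= t0 <-] /=; exists (r * t); first exact: mulr_ge0.
by rewrite ofRM scalerA mulrA.
Qed.

Lemma ray_le p x s : sublinear p -> s <= p x ->
  forall a, ray x s a -> a.2 <= p a.1.
Proof. by move=> lp sp _ [t /= t0 <-] /=; rewrite lp.2// ler_wpM2l. Qed.

Lemma ray1 x s : ray x s (x, s).
Proof. by exists 1 => /=; rewrite ?ler01// ofR1 scale1r mul1r. Qed.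

(* {u <= q} is an extreme face of {u <= p}, u ranging over linear functionals *)
Definition extremal_below p q := forall f g t, real_linear f -> real_linear g ->
  (forall x, f x <= p x) -> (forall x, g x <= p x) -> 0 < t < 1 ->
  (forall x, t * f x + (1 - t) * g x <= q x) ->
  (forall x, f x <= q x) /\ (forall x, g x <= q x).

(** A face of a face is a face: extremality of q puts f and g below q, and the averaged inequality
    at -a then forces f a = g a = q a. *)
Lemma extremal_ray p q a : sublinear q -> (forall x, q x <= p x) ->
  extremal_below p q ->
  extremal_below p (cone_inf q (ray a (q a))).
Proof.
move=> lq qp ep f g t lf lg fp gp t01 fgq.
have rq := ray_le lq (lexx (q a)).
have [fq gq] : (forall x, f x <= q x) /\ (forall x, g x <= q x).
  apply: (ep _ _ t) => // x; apply: le_trans (fgq x) _.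
  by apply: cone_inf_lep => //; [exact: ray0|exact: rayZ].
have : t * f (- a) + (1 - t) * g (- a) <= - q a.
  apply: (le_trans (fgq _)).
  have := cone_inf_le lq (ray0 _ _) rq (- a) (ray1 a (q a)).
  by rewrite /= addNr sublinear0// sub0r.
rewrite !real_linearN// => h.
have [/= t0 t1] := andP t01.
have fa : f a = q a.
  by have := fq a; have := gq a => ga fa; apply/eqP; rewrite eq_le fa /=; nra.
have ga : g a = q a.
  by have := fq a; have := gq a => ga' fa'; apply/eqP; rewrite eq_le ga' /=; nra.
have le h' (lh : real_linear h') : (forall x, h' x <= q x) -> h' a = q a ->
    forall x, h' x <= cone_inf q (ray a (q a)) x.
  move=> hq ha x; apply: (le_cone_inf lq (ray0 _ _) rq) => _ [s /= s0 <-] /=.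
  by rewrite lerBrDr -ha -lh.2 -lh.1.
by split; apply: le.
Qed.

(* A minimal element q of the sublinear functionals whose lower set is an
   extreme face is linear: replacing q by the functional describing the face
   [u a = q a] cannot decrease it, so q x + q a <= q (x + a). *)
Theorem extremal_hahn_banach p : sublinear p ->
  exists u, [/\ real_linear u, forall x, u x <= p x &
    forall f g t, real_linear f -> real_linear g ->
      (forall x, f x <= p x) -> (forall x, g x <= p x) -> 0 < t < 1 ->
      (forall x, u x = t * f x + (1 - t) * g x) -> f = u /\ g = u].
Proof.
move=> lp.
pose T := {q : V -> R | [/\ sublinear q, forall x, q x <= p x &
  extremal_below p q]}.
(* The order is reversed, so that the maximal element given by Zorn's lemma is pointwise minimal and
   chains are bounded by infima. *)
pose rel (q q' : T) := `[< forall x, sval q' x <= sval q x >].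
have pT : [/\ sublinear p, forall x, p x <= p x & extremal_below p p] by [].
have [|q q' q'' /asboolP h1 /asboolP h2|q q' /asboolP h1 /asboolP h2|
    C totC|m mmin] :=
    @Zorn T rel.
- by move=> q; apply/asboolP.
- by apply/asboolP => x; apply: le_trans (h2 x) (h1 x).
- case: q q' h1 h2 => [q qP] [q' q'P] /= h1 h2.
  have e : q = q' by apply/funext => x; apply/eqP; rewrite eq_le h1 h2.
  by move: q'P; rewrite -e => q'P; congr exist; exact: Prop_irrelevance.
- have [C0|/set0P[c0 Cc0]] := eqVneq C set0.
    by exists (exist _ p pT); rewrite C0.
  pose m (x : V) := inf [set sval q x | q in C].
  have infC x : has_inf [set sval q x | q in C].
    split; first by exists (sval c0 x), c0.
    exists (- p (- x)) => _ [q Cq <-]; have [lq qp _] := svalP q.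
    by apply: le_trans (sublinearN x lq); rewrite lerN2.
  have mle (q : T) x : C q -> m x <= sval q x.
    by move=> Cq; apply: ge_inf; [exact: (infC x).2|exists q].
  have mge x r : (forall q : T, C q -> r <= sval q x) -> r <= m x.
    by move=> h; apply: lb_le_inf; [exact: (infC x).1|move=> _ [q /h ? <-]].
  have mT : [/\ sublinear m, forall x, m x <= p x & extremal_below p m].
    split.
    + apply: sublinear_intro => [|x y|r x r0].
      * apply/eqP; rewrite eq_le.
        rewrite (le_trans (mle c0 _ Cc0)) /=; last first.
          by have [/sublinear0-> _ _] := svalP c0.
        by apply: (mge _) => q _; have [/sublinear0-> _ _] := svalP q.
      * rewrite -lerBlDr; apply: (mge _) => q Cq.
        rewrite lerBlDr [leRHS]addrC -lerBlDr.
        apply: (mge _) => q' Cq'; rewrite lerBlDr.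
        (* The smaller of q and q' serves both summands; this is where the chain hypothesis
           enters. *)
        have [/asboolP qq'|/asboolP qq'] := (totC _ _ Cq Cq').
          apply: (le_trans (mle _ _ Cq')); have [lq' _ _] := svalP q'.
          by apply: (le_trans (lq'.1 _ _)); rewrite addrC lerD2l.
        apply: (le_trans (mle _ _ Cq)); have [lq _ _] := svalP q.
        by apply: (le_trans (lq.1 _ _)); rewrite addrC lerD2r.
      * rewrite -ler_pdivrMl//; apply: (mge _) => q Cq; rewrite ler_pdivrMl//.
        apply: (le_trans (mle _ _ Cq)); have [lq _ _] := svalP q.
        by rewrite lq.2// ltW.
    + by move=> x; apply: (le_trans (mle _ _ Cc0)); have [] := svalP c0.
    + move=> f g t lf lg fp gp t01 fgm.
      have h (q : T) : C q ->
          (forall x, f x <= sval q x) /\ (forall x, g x <= sval q x).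
        move=> Cq; have [_ _ eq] := svalP q; apply: (eq _ _ t) => // x.
        exact: le_trans (fgm x) (mle _ _ Cq).
      by split=> x; apply: (mge _) => q /h[].
  exists (exist _ m mT) => q Cq; apply/asboolP => x /=; exact: mle.
have [lm mp em] := svalP m.
have lm' : real_linear (sval m).
  apply: sublinear_real_linear => // x y.
  have ry := ray_le lm (lexx (sval m y)).
  pose n := cone_inf (sval m) (ray y (sval m y)).
  have nm z : n z <= sval m z.
    by apply: cone_inf_lep => //; [exact: ray0|exact: rayZ].
  have nT : [/\ sublinear n, forall x, n x <= p x & extremal_below p n].
    split; last exact: extremal_ray.
      by apply: cone_inf_sublinear => //; [exact: ray0|exact: rayD|exact: rayZ].
    by move=> z; apply: le_trans (nm z) (mp z).
  have e : sval m = n.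
    by rewrite -(mmin (exist _ n nT) _)//; apply/asboolP.
  rewrite -lerBrDr [in leLHS]e.
  exact: (cone_inf_le lm (ray0 _ _) ry x (ray1 y (sval m y))).
exists (sval m); split=> // f g t lf lg fp gp t01 ufg.
have [fm gm] : (forall x, f x <= sval m x) /\ (forall x, g x <= sval m x).
  by apply: (em _ _ t) => // x; rewrite ufg.
by split; apply: real_linear_le.
Qed.

(** Any linear functional below [cone_inf] meets both requirements. *)
Theorem mazur_orlicz p (S : set (V * R)) : sublinear p -> S !=set0 ->
  (forall a b, S a -> S b -> S (a.1 + b.1, a.2 + b.2)) ->
  (forall r a, 0 <= r -> S a -> S (ofR k r *: a.1, r * a.2)) ->
  (forall a, S a -> a.2 <= p a.1) ->
  exists u, [/\ real_linear u, forall x, u x <= p x &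
    forall a, S a -> a.2 <= u a.1].
Proof.
move=> lp S0 SD SZ Sp.
have [u [lu uS _]] := extremal_hahn_banach (cone_inf_sublinear lp S0 SD SZ Sp).
exists u; split=> // [x|]; last exact: cone_inf_linear lu uS.
exact: le_trans (uS x) (cone_inf_lep lp S0 SZ Sp x).
Qed.

End hahn_banach.

(** * Convex hulls, separation and norming extreme functionals *)

Section convexity.
Context {R : realType} {k : scalar_kind}.
Local Notation K := (scalars R k).

Lemma convex_setP (V : lmodType K) (C : set V) :
  @convex_set K V C <-> forall x y (t : R), C x -> C y -> 0 <= t <= 1 ->
    C (ofR k t *: x + ofR k (1 - t) *: y).
Proof.
split=> [cC x y t Cx Cy /andP[t0 t1]|cC x y l /set_mem Cx /set_mem Cy].
  have t0' : 0 <= ofR k t :> K by rewrite -ofR0 ler_ofR.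
  have t1' : ofR k t <= 1 :> K by rewrite -ofR1 ler_ofR.
  have := cC x y (Itv01 t0' t1') (mem_set Cx) (mem_set Cy).
  by move=> /set_mem; rewrite /conv/= ofRB ofR1.
apply/mem_set; have l0 : 0 <= l%:num by [].
have l1 : l%:num <= 1 by [].
have -> : (conv l (x : convex_lmodType V) y : V) =
    ofR k (reK l%:num) *: x + ofR k (1 - reK l%:num) *: y.
  by rewrite ofRB ofR1 reK_ge0.
apply: cC => //; rewrite -!(ler_ofR (k := k)) ofR0 ofR1 reK_ge0//.
by apply/andP.
Qed.

Section normed.
Context {V : normedModType K}.
Implicit Types (A C : set V).

Lemma conv_hull_convex A : @convex_set K V (conv_hull A).
Proof.
apply/convex_setP => x y t Ax Ay t01 C [/convex_setP cC sAC].
by apply: (cC) => //; [apply: (Ax)|apply: (Ay)]; split => //; apply/convex_setP.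
Qed.

Lemma sub_conv_hull A : A `<=` conv_hull A.
Proof. by move=> x Ax C [_ sAC]; exact: sAC. Qed.

Lemma conv_hull_sub A C : @convex_set K V C -> A `<=` C -> conv_hull A `<=` C.
Proof. by move=> cC sAC x; apply. Qed.

Lemma conv_hull_half A (u : V -> R) (M : R) : real_linear u ->
  (forall x, A x -> u x <= M) -> forall x, conv_hull A x -> u x <= M.
Proof.
move=> [uD uZ] uA; apply: conv_hull_sub => //; apply/convex_setP => x y t.
by move=> xM yM /andP[t0 t1]; rewrite uD !uZ; nra.
Qed.

Lemma aconv_half A (u : V -> R) (M : R) : real_linear u ->
  (forall w x, unit_scalars K w -> A x -> u (w *: x) <= M) ->
  forall x, aconv A x -> u x <= M.
Proof.
by move=> lu uA; apply: conv_hull_half => // _ [w w1 [x Ax <-]]; exact: uA.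
Qed.

Lemma unit_ball_convex : @convex_set K V (unit_ball V).
Proof.
apply/convex_setP => x y t /unit_ball_rnorm x1 /unit_ball_rnorm y1 /andP[t0 t1].
apply/unit_ball_rnorm; rewrite (le_trans (ler_rnormD _ _))//.
rewrite !rnormZofR !ger0_norm//.
  nra.
by rewrite subr_ge0.
Qed.

Lemma rnorm_sublinear : sublinear (@rnorm R k V).
Proof.
split=> [x y|r x r0]; first exact: ler_rnormD.
by rewrite rnormZofR ger0_norm.
Qed.

(** The pairs (t c, t r) with c in C and t >= 0 form a cone of constraints dominated by the norm, so
    [mazur_orlicz] applies. *)
Lemma separation C (r : R) : C !=set0 -> @convex_set K V C ->
  0 <= r -> (forall c, C c -> r <= rnorm c) ->
  exists2 f : dual V, rnorm f <= 1 & forall c, C c -> r <= reK (f c).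
Proof.
move=> [c0 Cc0] /convex_setP cC r0 rC.
pose S : set (V * R) := [set a | exists t c,
  [/\ 0 <= t, C c & a = (ofR k t *: c, t * r)]].
have [|a b [t [c [t0 Cc ->]]] [s [d [s0 Cd ->]]]|t a t0 [s [d [s0 Cd ->]]]||u] :=
    @mazur_orlicz R k V (@rnorm R k V) S rnorm_sublinear.
- by exists (ofR k 0 *: c0, 0 * r), 0, c0.
- have [ts|ts] := eqVneq (t + s) 0.
    have t0' : t = 0 by apply/eqP; rewrite eq_le t0 andbT -ts lerDl.
    by exists s, d; split=> //=; rewrite t0' ofR0 scale0r mul0r !add0r.
  have ts0 : 0 < t + s by rewrite lt_neqAle eq_sym ts addr_ge0.
  (* t c + s d is t + s times a convex combination of c and d. *)
  exists (t + s), (ofR k (t / (t + s)) *: c + ofR k (1 - t / (t + s)) *: d).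
  split; first exact: ltW.
    by apply: cC => //; rewrite divr_ge0 ?(ltW ts0)//= ler_pdivrMr// mul1r lerDl.
  have tE : (t + s) * (t / (t + s)) = t by rewrite mulrCA divff// mulr1.
  have sE : (t + s) * (1 - t / (t + s)) = s.
    by rewrite mulrBr mulr1 tE addrC addKr.
  by rewrite /= scalerDr !scalerA -!ofRM tE sE mulrDl.
- by exists (t * s), d; split; rewrite ?mulr_ge0//= ofRM scalerA mulrA.
- move=> _ [t [c [t0 Cc ->]]] /=.
  by rewrite rnormZofR ger0_norm// ler_wpM2l// rC.
move=> [lu un uS]; have [|x|f f1 fu] := @dual_of_real _ _ _ u 1 _ lu => //.
  by rewrite mul1r.
exists f => // c Cc; rewrite fu.
have /uS : S (c, r) by exists 1, c; rewrite ofR1 scale1r mul1r.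
by [].
Qed.

(** q describes the face of the dual ball formed by the functionals norming y. An extreme point of
    this face is extreme in the ball, because q is extremal below the norm. *)
Lemma ext_norming (y : V) :
  exists2 e : dual V, ext (unit_ball (dual V)) e & reK (e y) = rnorm y.
Proof.
have lp := rnorm_sublinear; have rp := ray_le lp (lexx (rnorm y)).
have ep : extremal_below (@rnorm R k V) (@rnorm R k V) by [].
have {}ep := extremal_ray (a := y) lp (fun _ => lexx _) ep.
set q := cone_inf _ _ in ep.
have lq : sublinear q.
  by apply: cone_inf_sublinear => //; [exact: ray0|exact: rayD|exact: rayZ].
have qp x : q x <= rnorm x.
  by apply: cone_inf_lep => //; [exact: ray0|exact: rayZ].
have [u [lu uq eu]] := extremal_hahn_banach lq.
have [|x|f f1 fu] := @dual_of_real _ _ _ u 1 _ lu => //.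
  by rewrite mul1r (le_trans (uq _)).
have fy : reK (f y) = rnorm y.
  apply/eqP; rewrite eq_le dual_ball//= fu.
  exact: (cone_inf_linear lp (ray0 _ _) rp lu uq (ray1 y (rnorm y))).
exists f => //; split; first exact/unit_ball_rnorm.
move=> g h t /unit_ball_rnorm g1 /unit_ball_rnorm h1 t01 fgh.
have e x : u x = t * reK (g x) + (1 - t) * reK (h x).
  by rewrite -fu fgh -!reKZ -reKD.
have gn x := dual_ball x g1; have hn x := dual_ball x h1.
have [lg lh] := (dual_real_linear g, dual_real_linear h).
have [|gq hq] := ep _ _ t lg lh gn hn t01; first by move=> x; rewrite -e.
have [ge he] := eu _ _ t lg lh gq hq t01 e.
split; apply: dual_reK_eq => x; rewrite fu.
  exact: (congr1 (fun v => v x) ge).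
exact: (congr1 (fun v => v x) he).
Qed.

Lemma norming (y : V) : exists2 f : dual V, rnorm f <= 1 & reK (f y) = rnorm y.
Proof. by have [e [/unit_ball_rnorm e1 _] ey] := ext_norming y; exists e. Qed.

End normed.
End convexity.

(** * The weak* topology: basic neighbourhoods and a bipolar theorem *)

Section weak_star.
Context {R : realType} {k : scalar_kind} {V : normedModType (scalars R k)}.
Local Notation K := (scalars R k).
Implicit Types (f g : dual V) (x : V).

(** The topology is that of pointwise convergence in [K]; the imaginary part of f x is controlled by
    the real part of f at [imK R k *: x]. *)
Lemma weak_star_cvg (F : set_system (dual V)) f : Filter F ->
  (forall x (e : R), 0 < e -> F [set g | `|reK (g x) - reK (f x)| < e]) ->
  forall A, nbhs (f : weak_star V) A -> F A.
Proof.
move=> FF Ff A [_ [[B oB <-] Bf] BA]; apply: filterS BA _.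
suff /pointwise_cvgP FB : forall x,
    (fun h : V -> K^o => h x) @ ((fun g : dual V => blop_fun g) @ F) --> f x.
  by apply: FB; exact: open_nbhs_nbhs.
move=> x U /nbhs_ballP[d /= d0 dU].
have rd : 0 < reK d by rewrite -(ltr_ofR (k := k)) ofR0 reK_ge0// ltW.
have d2 : 0 < reK d / 2 by lra.
suff : F [set g : dual V | U (g x)] by [].
apply: (filterS _ (filterI (Ff x _ d2) (Ff (imK R k *: x) _ d2))) => g [/= g1 g2].
apply: dU; rewrite -ball_normE /= distrC -[d]reK_ge0 ?ltW// -rnormE ltr_ofR.
apply: (le_lt_trans (ler_rnorm_reK _)).
move: g2; rewrite !linearZ -!reKB /= -scalerBr => g2.
by move: g1; rewrite -reKB; lra.
Qed.

Lemma weak_star_nbhs f x (e : R) : 0 < e ->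
  nbhs (f : weak_star V) [set g | `|reK (g x) - reK (f x)| < e].
Proof.
move=> e0; have ic := @initial_continuous (dual V) _
  (fun f : dual V => (blop_fun f : {ptws V -> K^o})) f.
have pc := @proj_continuous V (fun=> K^o) x (blop_fun f).
have fe : nbhs (f x : K^o) [set z | rnorm (f x - z : K^o) < e].
  by apply/nbhs_rnormP; exists e.
have fne := ic _ (pc _ fe).
apply: (@filterS (weak_star V) (nbhs (f : weak_star V)) _ _ _ _ fne) => g.
rewrite /= /proj => fg.
by rewrite distrC -reKB (le_lt_trans (ler_norm_reK _)).
Qed.

(** The sets containing a basic neighbourhood form a filter, to which [weak_star_cvg] applies. *)
Lemma weak_star_basis f (A : set (dual V)) : nbhs (f : weak_star V) A ->
  exists (s : seq V) (e : R), 0 < e /\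
    forall g, (forall x, x \in s -> `|reK (g x) - reK (f x)| < e) -> A g.
Proof.
pose F : set_system (dual V) := [set B | exists (s : seq V) (e : R), 0 < e /\
  forall g, (forall x, x \in s -> `|reK (g x) - reK (f x)| < e) -> B g].
apply: (@weak_star_cvg F f) => [|x e e0]; last first.
  by exists [:: x], e; split=> // g; apply; rewrite mem_head.
split=> [|B C [s [e [e0 sB]]] [t [d [d0 tC]]]|B C BC [s [e [e0 sB]]]].
- by exists [::], 1.
- exists (s ++ t), (Num.min e d); split; first by rewrite lt_min e0.
  move=> g gst; split; [apply: sB|apply: tC] => x xs.
    by have := gst x; rewrite mem_cat xs lt_min => /(_ isT)/andP[].
  by have := gst x; rewrite mem_cat xs orbT lt_min => /(_ isT)/andP[].
- by exists s, e; split=> // g /sB/BC.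
Qed.

Lemma wclosure_ball (A : set (dual V)) :
  A `<=` unit_ball (dual V) -> wclosure A `<=` unit_ball (dual V).
Proof.
move=> AB f Af; apply/unit_ball_rnorm/dual_rnorm_le => x x1.
apply/ler_addgt0Pr => e e0.
have [g [/AB/unit_ball_rnorm g1 /= gf]] := Af _ (weak_star_nbhs f x e0).
have := dual_ball x g1; move: gf; rewrite ltr_norml => /andP[]; lra.
Qed.

(* If C misses a basic neighbourhood of f, given by finitely many vectors, then
   the corresponding finite-dimensional image of C - f is separated from 0 for
   the l^1 norm. *)
Lemma bipolar (C : set (dual V)) f : @convex_set K (dual V) C ->
  (forall x (e : R), 0 < e -> exists2 g, C g & reK (f x) - e < reK (g x)) ->
  wclosure C f.
Proof.
move=> /convex_setP cC fC A /weak_star_basis[s [e [e0 sA]]].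
apply: contrapT => nA.
pose n := size s; pose E := 'rV[R]_n.
pose ev g : E := \row_i (reK (g s`_i) - reK (f s`_i)).
have Cev g : C g -> e <= \sum_i `|ev g 0 i|.
  move=> Cg; rewrite leNgt; apply/negP => ge; apply: nA; exists g; split => //.
  apply: sA => x /(nthP 0)[i si <-]; apply: le_lt_trans ge.
  rewrite (bigD1 (Ordinal si))//= mxE lerDl.
  by apply: sumr_ge0.
pose p (h : E) := \sum_i `|h 0 i|.
have lp : @sublinear R RealScalars E p.
  split=> [h h'|r h r0]; rewrite /p.
    by rewrite -big_split ler_sum// => i _; rewrite mxE ler_normD.
  by rewrite mulr_sumr; apply: eq_bigr => i _; rewrite mxE normrM ger0_norm.
have [g0 Cg0 _] := fC 0 1 ltr01.
pose S : set (E * R) := [set a | exists t g,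
  [/\ 0 <= t, C g & a = (t *: ev g, t * e)]].
have [|a b [t [c [t0 Cc ->]]] [r [d [r0 Cd ->]]]|t a t0 [r [d [r0 Cd ->]]]||u] :=
    @mazur_orlicz R RealScalars E p S lp.
- by exists (0 *: ev g0, 0 * e), 0, g0.
- have [tr|tr] := eqVneq (t + r) 0.
    have t0' : t = 0 by apply/eqP; rewrite eq_le t0 andbT -tr lerDl.
    by exists r, d; split=> //=; rewrite t0' scale0r mul0r !add0r.
  have tr0 : 0 < t + r by rewrite lt_neqAle eq_sym tr addr_ge0.
  exists (t + r), (ofR k (t / (t + r)) *: c + ofR k (1 - t / (t + r)) *: d).
  split; first exact: ltW.
    apply: cC => //.
    by rewrite divr_ge0 ?(ltW tr0)//= ler_pdivrMr// mul1r lerDl.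
  congr pair; last by rewrite /= mulrDl.
  apply/rowP => i; rewrite !mxE /= reKD !reKZ.
  by field.
- by exists (t * r), d; split; rewrite ?mulr_ge0//= scalerA mulrA.
- move=> _ [t [g [t0 Cg ->]]] /=; rewrite lp.2//.
  by apply: ler_wpM2l => //; exact: Cev.
move=> [lu _ uS].
have uE h : u h = \sum_i h 0 i * u (delta_mx 0 i).
  rewrite {1}[h]row_sum_delta.
  elim/big_rec2: _ => [|i y z _ <-]; first exact: real_linear0 lu.
  by rewrite lu.1 (lu.2 (h 0 i)).
(* The coordinates of u combine the vectors of s into one vector x with Re (g - f) x = u (ev g) >= e
   on C, against the hypothesis at -x. *)
pose x := \sum_i ofR k (u (delta_mx 0 i)) *: s`_i.
have xE g : reK (g x) - reK (f x) = u (ev g).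
  rewrite uE /x !linear_sum /=.
  have rs (h : 'I_n -> K) : reK (\sum_i h i) = \sum_i reK (h i).
    by elim/big_rec2: _ => [|i y z _ <-]; rewrite ?reK0// reKD.
  rewrite !rs -sumrB; apply: eq_bigr => i _.
  by rewrite !linearZ/= !reKZ mxE -mulrBr mulrC.
pose m := - x.
have [g Cg] := fC m _ e0; rewrite /m !linearN !reKN.
have : e <= u (ev g).
  by apply: (uS (ev g, e)); exists 1, g; rewrite scale1r mul1r.
by rewrite -xE; lra.
Qed.

End weak_star.

(** * Slices at extreme points of the dual ball *)

Section choquet.
Context {R : realType} {k : scalar_kind} {V : normedModType (scalars R k)}.
Local Notation K := (scalars R k).
Implicit Types (e f g : dual V) (x y : V).

(** The support function of A. *)
Definition sup_functional (A : set (dual V)) x : R :=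
  sup [set reK (f x) | f in A].

Section sup_functional.
Variable A : set (dual V).
Hypotheses (A0 : A !=set0) (AB : A `<=` unit_ball (dual V)).

Let supA x : has_sup [set reK (f x) | f in A].
Proof.
split; first by have [f Af] := A0; exists (reK (f x)), f.
by exists (rnorm x) => _ [f /AB/unit_ball_rnorm f1 <-]; exact: dual_ball.
Qed.

Lemma sup_functional_ge f x : A f -> reK (f x) <= sup_functional A x.
Proof. by move=> Af; apply: ub_le_sup; [exact: (supA x).2|exists f]. Qed.

Lemma sup_functional_le x (M : R) :
  (forall f, A f -> reK (f x) <= M) -> sup_functional A x <= M.
Proof. by move=> h; apply: ge_sup; [exact: (supA x).1|move=> _ [f /h ? <-]]. Qed.

Lemma sup_functional_sublinear : sublinear (sup_functional A).
Proof.
have lin f := dual_real_linear f.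
apply: sublinear_intro => [|x y|r x r0].
- have [f Af] := A0; apply/eqP; rewrite eq_le sup_functional_le/=.
    by rewrite -(real_linear0 (lin f)) sup_functional_ge.
  by move=> g _; rewrite (real_linear0 (lin g)).
- by apply: sup_functional_le => f Af; rewrite (lin f).1 lerD// sup_functional_ge.
- apply: sup_functional_le => f Af; rewrite (lin f).2 ler_pM2l//.
  exact: sup_functional_ge.
Qed.

End sup_functional.

(** If e had norm below 1 and f differed from e, then e would be the midpoint of e + t (f - e) and e
    - t (f - e), both in the ball for small t. The second alternative is a zero dual space. *)
Lemma ext_ball_norm e : ext (unit_ball (dual V)) e ->
  rnorm e = 1 \/ forall f, f = e.
Proof.
move=> [/unit_ball_rnorm e1 ext_e].
have [/eqP|ne1] := boolP (rnorm e == 1); first by left.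
right=> f; apply: contrapT => /eqP fe.
have {}e1 : rnorm e < 1 by rewrite lt_neqAle ne1.
have fe0 : 0 < rnorm (f - e) by rewrite rnorm_gt0// subr_eq0.
pose t := (1 - rnorm e) / rnorm (f - e).
have t0 : 0 < t by rewrite divr_gt0// subr_gt0.
have b (r : R) : `|r| = t -> unit_ball (dual V) (e + ofR k r *: (f - e)).
  move=> rt; apply/unit_ball_rnorm; rewrite (le_trans (ler_rnormD _ _))//.
  by rewrite rnormZofR rt /t divfK ?gt_eqF// addrC subrK.
have [||||/eqP] :=
  ext_e (e + ofR k t *: (f - e)) (e + ofR k (- t) *: (f - e)) 2^-1.
- by apply: b; rewrite gtr0_norm.
- by apply: b; rewrite normrN gtr0_norm.
- by apply/andP; split; lra.
- move: (f - e) => h; rewrite !scalerDr !scalerA -!ofRM addrACA -!scalerDl -!ofRD.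
  have -> : 2^-1 + (1 - 2^-1) = 1 :> R by field.
  have -> : 2^-1 * t + (1 - 2^-1) * - t = 0 by field.
  by rewrite ofR1 ofR0 scale1r scale0r addr0.
rewrite -subr_eq0 addrC addKr scaler_eq0 subr_eq0 (negbTE fe) orbF.
by rewrite -ofR0 (inj_eq (can_inj (@ofRK R k))) gt_eqF.
Qed.

(** With r the norm of f, extremality applied to f / r and g / (1 - r) gives f = r e and g = (1 - r)
    e; zero summands are treated apart. *)
Lemma ext_ball_split e f g : ext (unit_ball (dual V)) e ->
  rnorm f + rnorm g <= 1 -> e = f + g ->
  exists r : R, forall x y,
    reK (f x) + reK (g y) = r * reK (e x) + (1 - r) * reK (e y).
Proof.
move=> [_ ext_e] fg1 efg; have [f0|fn0] := eqVneq f 0.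
  by exists 0 => x y; rewrite efg f0 add0r reK0 subr0 mul0r mul1r.
have [g0|gn0] := eqVneq g 0.
  by exists 1 => x y; rewrite efg g0 addr0 reK0 subrr mul0r mul1r.
have f0 := rnorm_gt0 fn0; have g0 := rnorm_gt0 gn0.
set r := rnorm f in f0 fg1; exists r => x y.
have r1 : 0 < 1 - r by lra.
have [||||fe ge] := ext_e (ofR k r^-1 *: f) (ofR k (1 - r)^-1 *: g) r.
- apply/unit_ball_rnorm; rewrite rnormZofR gtr0_norm ?invr_gt0//.
  by rewrite mulVf// gt_eqF.
- apply/unit_ball_rnorm; rewrite rnormZofR gtr0_norm ?invr_gt0//.
  rewrite ler_pdivrMl// mulr1.
  lra.
- by rewrite f0 /=; lra.
- by rewrite !scalerA -!ofRM !divff ?gt_eqF// ofR1 !scale1r.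
rewrite -[in reK (e x)]fe -[in reK (e y)]ge !blopZE !reKZ !mulrA.
by rewrite !divff ?gt_eqF// !mul1r.
Qed.

(* If no slice works, e is dominated by max (p, q), where p and q are the support
   functions of the parts of the ball cut off by the two half-spaces. Extending
   e from the diagonal of V * V splits it into two functionals, which are
   multiples of e by extremality; a suitable pair of vectors then contradicts
   the domination. *)
Lemma slice_inter e x1 x2 (e1 e2 : R) : ext (unit_ball (dual V)) e ->
  0 < e1 -> 0 < e2 -> reK (e x1) <= reK (e x2) ->
  exists (x : V) (d : R), 0 < d /\ forall f, rnorm f <= 1 ->
    reK (e x) - d < reK (f x) ->
    reK (e x1) - e1 < reK (f x1) /\ reK (e x2) - e2 < reK (f x2).
Proof.
move=> ext_e e10 e20 ex12.
have [en1|triv] := ext_ball_norm ext_e; last first.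
  by exists 0, 1; split=> // f _ _; rewrite (triv f); lra.
pose A y d : set (dual V) :=
  [set f | unit_ball (dual V) f /\ reK (f y) <= reK (e y) - d].
have AB y d : A y d `<=` unit_ball (dual V) by move=> f [].
have nA y d f : rnorm f <= 1 -> ~ A y d f -> reK (e y) - d < reK (f y).
  move=> f1 nAf; rewrite ltNge; apply/negP => h; apply: nAf.
  by split=> //; exact/unit_ball_rnorm.
have [A1|/set0P A1] := eqVneq (A x1 e1) set0.
  exists x2, e2; split=> // f f1 fx; split=> //; apply: nA => //.
  by rewrite A1.
have [A2|/set0P A2] := eqVneq (A x2 e2) set0.
  exists x1, e1; split=> // f f1 fx; split=> //; apply: nA => //.
  by rewrite A2.
apply: contrapT => nslice.
have slice x (d : R) : 0 < d -> exists2 f, A x1 e1 f \/ A x2 e2 f &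
    reK (e x) - d < reK (f x).
  move=> d0; apply: contrapT => /forall2NP h; apply: nslice.
  exists x, d; split=> // f f1 fx.
  by have [/not_orP[h1 h2]|//] := h f; split; apply: nA.
pose p := sup_functional (A x1 e1); pose q := sup_functional (A x2 e2).
have lp : sublinear p by exact: sup_functional_sublinear.
have lq : sublinear q by exact: sup_functional_sublinear.
have pn x : p x <= rnorm x.
  by apply: sup_functional_le => // f /AB/unit_ball_rnorm f1; exact: dual_ball.
have qn x : q x <= rnorm x.
  by apply: sup_functional_le => // f /AB/unit_ball_rnorm f1; exact: dual_ball.
have epq x : reK (e x) <= Num.max (p x) (q x).
  apply/ler_addgt0Pr => d d0; have [f Af /ltW fx] := slice x d d0.
  rewrite -lerBlDr (le_trans fx)// le_max.
  case: Af => Af; first by rewrite (sup_functional_ge A1 (@AB x1 e1)).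
  by rewrite (sup_functional_ge A2 (@AB x2 e2)) ?orbT.
pose P (z : V * V) := Num.max (p z.1) (q z.2).
have lP : @sublinear R k (V * V)%type P.
  split=> [z z'|r z r0]; rewrite /P /=.
    rewrite ge_max; apply/andP; split.
      by rewrite (le_trans (lp.1 _ _))// lerD// le_max lexx.
    by rewrite (le_trans (lq.1 _ _))// lerD// le_max lexx orbT.
  by rewrite lp.2// lq.2// maxr_pMr.
pose S : set (V * V * R) := [set (z, z, reK (e z)) | z in [set: V]].
have le := dual_real_linear e.
have [|a b [z _ <-] [z' _ <-]|r a r0 [z _ <-]|a [z _ <-]|E [lE EP ES]] :=
    @mazur_orlicz R k (V * V)%type P S lP.
- by exists (0, 0, reK (e 0)), 0.
- by exists (z + z') => //=; rewrite le.1.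
- by exists (ofR k r *: z) => //=; rewrite le.2.
- exact: epq.
have Ee z : E (z, z) = reK (e z).
  have h y : reK (e y) <= E (y, y) by apply: (ES (y, y, reK (e y))); exists y.
  apply/eqP; rewrite eq_le h andbT; have := h (- z).
  by rewrite (real_linearN le) -[(- z, - z)]/(- (z, z)) (real_linearN lE) lerN2.
have ED x y : E (x, y) = E (x, 0) + E (0, y).
  by rewrite -lE.1; congr E; congr pair; rewrite /= ?addr0 ?add0r.
have En x y : E (x, y) <= Num.max (rnorm x) (rnorm y).
  by rewrite (le_trans (EP _))// ge_max !le_max pn qn orbT.
have lE1 : real_linear (fun x => E (x, 0)).
  split=> [x y|r x]; rewrite -?lE.1 -?lE.2; congr E; congr pair => /=.
    by rewrite addr0.
  by rewrite scaler0.
have lE2 : real_linear (fun x => E (0, x)).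
  split=> [x y|r x]; rewrite -?lE.1 -?lE.2; congr E; congr pair => /=.
    by rewrite addr0.
  by rewrite scaler0.
have [x|f f1 fE] := dual_of_real ler01 lE1.
  by rewrite mul1r (le_trans (En _ _))// rnorm0 ge_max lexx rnorm_ge0.
have [x|g g1 gE] := dual_of_real ler01 lE2.
  by rewrite mul1r (le_trans (En _ _))// rnorm0 ge_max lexx rnorm_ge0.
(* E is bounded by the max norm on V * V, and the dual of the max norm is the sum of the norms. *)
have fg1 : rnorm f + rnorm g <= 1.
  rewrite leNgt; apply/negP => fg.
  pose d := (rnorm f + rnorm g - 1) / 2; have d0 : 0 < d by rewrite /d; lra.
  have [x nx fx] := @dual_rnorm_gt _ _ _ f (rnorm f - d) ltac:(lra).
  have [y ny gy] := @dual_rnorm_gt _ _ _ g (rnorm g - d) ltac:(lra).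
  have := En x y; rewrite ED -fE -gE => h.
  have : Num.max (rnorm x) (rnorm y) <= 1 by rewrite ge_max nx.
  by move: fx gy h; rewrite /d; lra.
have efg : e = f + g.
  apply: dual_reK_eq => x; rewrite -Ee ED -fE -gE.
  by rewrite [(f + g) x]blopDE reKD.
have [r rE] := ext_ball_split ext_e fg1 efg.
(* shift x1 by y0 so that e takes the same value on both vectors *)
have [y0 ey0 ny0] : exists2 y0, reK (e y0) = reK (e x2) - reK (e x1) &
    rnorm y0 <= reK (e x2) - reK (e x1) + e1 / 2.
  set d := reK (e x2) - reK (e x1); have : 0 <= d by rewrite subr_ge0.
  rewrite le_eqVlt => /predU1P[<-|d0].
    by exists 0; rewrite ?(real_linear0 le)// rnorm0; lra.
  have de0 : 0 < d + e1 / 2 by lra.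
  have [|y y1 ey] := @dual_rnorm_gt _ _ _ e (d / (d + e1 / 2)).
    by rewrite en1 ltr_pdivrMr// mul1r; lra.
  have ey0 : 0 < reK (e y) by apply: lt_trans ey; rewrite divr_gt0.
  exists (ofR k (d / reK (e y)) *: y).
    by rewrite le.2 divfK// gt_eqF.
  rewrite rnormZofR gtr0_norm ?divr_gt0//.
  rewrite (@le_trans _ _ (d / reK (e y)))//; last first.
    by rewrite ler_pdivrMr// mulrC -ler_pdivrMr// ltW.
  by rewrite ler_piMr// ltW// divr_gt0.
(* Whatever r is, E takes the value Re e x2 at this pair, while p (x1 + y0) and q x2 are both
   strictly smaller. *)
have := EP (x1 + y0, x2); rewrite ED -fE -gE rE le.1 ey0.
have -> : r * (reK (e x1) + (reK (e x2) - reK (e x1))) + (1 - r) * reK (e x2)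
  = reK (e x2) by ring.
rewrite leNgt => /negP; apply; rewrite /P gt_max /=; apply/andP; split.
  rewrite (le_lt_trans (lp.1 _ _))//.
  have : p x1 <= reK (e x1) - e1 by apply: sup_functional_le => // f' [].
  by have := pn y0; lra.
have : q x2 <= reK (e x2) - e2 by apply: sup_functional_le => // f' [].
lra.
Qed.

(** Slices are merged one vector at a time by [slice_inter], whose hypothesis orders the two values
    of e; hence the two cases. *)
Lemma slice_sub_seq e (s : seq V) (d : R) : ext (unit_ball (dual V)) e ->
  0 < d -> exists (x : V) (d' : R), 0 < d' /\ forall f, rnorm f <= 1 ->
    reK (e x) - d' < reK (f x) ->
    forall y, y \in s -> reK (e y) - d < reK (f y).
Proof.
move=> ext_e d0; elim: s => [|y s [x [d' [d'0 IH]]]].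
  by exists 0, 1.
have [exy|/ltW exy] := leP (reK (e x)) (reK (e y)).
  have [z [d'' [d''0 h]]] := slice_inter ext_e d'0 d0 exy.
  exists z, d''; split=> // f f1 /(h f f1)[fx fy] u.
  by rewrite in_cons => /predU1P[->//|]; exact: IH.
have [z [d'' [d''0 h]]] := slice_inter ext_e d0 d'0 exy.
exists z, d''; split=> // f f1 /(h f f1)[fy fx] u.
by rewrite in_cons => /predU1P[->//|]; exact: IH.
Qed.

(* Choquet's lemma: slices form a neighbourhood base at an extreme point. *)
Lemma choquet e (A : set (dual V)) : ext (unit_ball (dual V)) e ->
  nbhs (e : weak_star V) A ->
  exists (x : V) (d : R), 0 < d /\ forall f, rnorm f <= 1 ->
    reK (e x) - d < reK (f x) -> A f.
Proof.
move=> ext_e /weak_star_basis[s [d [d0 sA]]].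
(* Including the opposite vectors turns one-sided bounds into two-sided ones. *)
have [x [d' [d'0 h]]] := slice_sub_seq (s ++ map -%R s) ext_e d0.
exists x, d'; split=> // f f1 /(h f f1) fs; apply: sA => y ys.
rewrite ltr_norml; apply/andP; split.
  by have := fs y; rewrite mem_cat ys => /(_ isT); lra.
have := fs (- y); rewrite mem_cat map_f// orbT => /(_ isT).
by rewrite !linearN !reKN; lra.
Qed.

End choquet.

(** * Spear vectors and extreme functionals *)

Section spear.
Context {R : realType} {k : scalar_kind}.
Local Notation K := (scalars R k).

Section spear_vectors.
Context {V : normedModType K}.
Implicit Types (x z : V).

Let rot_has_sup z x :
  has_sup [set rnorm (z + w *: x) | w in unit_scalars K].
Proof.
split; first by exists (rnorm (z + 1 *: x)), 1 => //; exact: unit_scalars1.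
exists (rnorm z + rnorm x) => _ [w w1 <-].
by rewrite (le_trans (ler_rnormD _ _))// rnormZ_unit.
Qed.

Lemma sup_rot_intro z x : rnorm z = 1 ->
  (forall e : R, 0 < e ->
    exists2 w, unit_scalars K w & 1 + rnorm x - e <= rnorm (z + w *: x)) ->
  sup [set rnorm (z + w *: x) | w in unit_scalars K] = 1 + rnorm x.
Proof.
move=> z1 h; apply/eqP; rewrite eq_le; apply/andP; split.
  apply: ge_sup; first exact: (rot_has_sup z x).1.
  move=> _ [w w1 <-].
  by rewrite (le_trans (ler_rnormD _ _))// rnormZ_unit// z1.
apply/ler_addgt0Pr => e /h[w w1 wx]; rewrite -lerBlDr (le_trans wx)//.
by apply: ub_le_sup; [exact: (rot_has_sup z x).2|exists w].
Qed.

Lemma sup_rot_gt z x (r e : R) :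
  sup [set rnorm (z + w *: x) | w in unit_scalars K] = r -> 0 < e ->
  exists2 w, unit_scalars K w & r - e < rnorm (z + w *: x).
Proof.
move=> <- e0; have [_ [w w1 <-] wx] := sup_adherent e0 (rot_has_sup z x).
by exists w.
Qed.

(** If |e z| < 1, Choquet's lemma gives a slice around e, defined by some x, on which |f z| stays
    away from 1. A functional norming z + w x is, up to rotation, in that slice, so this norm cannot
    approach 1 + ||x||. *)
Lemma spear_ext z : Spear V z ->
  forall e : dual V, ext (unit_ball (dual V)) e -> rnorm (e z : K^o) = 1.
Proof.
move=> [/rnorm1P z1 sz] e ext_e; have [/unit_ball_rnorm e1 _] := ext_e.
apply/eqP; rewrite eq_le (le_trans (dual_ball_norm z e1)) ?z1//=.
rewrite leNgt; apply/negP => ez; pose d := 1 - rnorm (e z : K^o).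
have d4 : 0 < d / 4 by rewrite /d; lra.
have eA : nbhs (e : weak_star V) [set f | rnorm (f z : K^o) < 1 - d / 2].
  have h1 := weak_star_nbhs e z d4; have h2 := weak_star_nbhs e (imK R k *: z) d4.
  apply: (@filterS (weak_star V) (nbhs (e : weak_star V)) _ _ _ _
    (filterI h1 h2)).
  move=> f [/= f1]; rewrite !dualZ -reKB -mulrBr => f2.
  have := ler_rnorm_dist (f z : K^o) (e z) 0; rewrite !subr0.
  have := ler_rnorm_reK (f z - e z); rewrite reKB.
  by rewrite /d in f1 f2 *; lra.
have [x [d' [d'0 h]]] := choquet ext_e eA.
(* The error d' puts w f in the slice; the error d / 2 contradicts |f z| < 1 - d / 2. *)
have m0 : 0 < Num.min d' (d / 2) by rewrite lt_min d'0; lra.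
have [w w1] := sup_rot_gt (sz x) m0.
have [f f1 <-] := norming (z + w *: x).
have wf1 : rnorm (w *: f) <= 1 by rewrite rnormZ_unit.
have := h _ wf1; rewrite !blopZE reK_dualD dualZ => {}h hx.
have wx : reK (w * f x) <= rnorm x := dual_ball x wf1.
have fz := ler_reK_norm (f z); have ex := dual_ball x e1.
have fz1 := dual_ball_norm z f1.
have m1 : Num.min d' (d / 2) <= d' by rewrite ge_min lexx.
have m2 : Num.min d' (d / 2) <= d / 2 by rewrite ge_min lexx orbT.
rewrite z1 in fz1; have : rnorm (w *: f z : K^o) < 1 - d / 2.
  by apply: h; rewrite -[w *: _]/(w * _); lra.
by rewrite rnormZ_unit//; lra.
Qed.

(** For e extreme and norming x, choose w with w (e z) = 1; then e shows that w z + x has norm at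
    least 1 + ||x||. *)
Lemma ext_spear z :
  (forall e : dual V, ext (unit_ball (dual V)) e -> rnorm (e z : K^o) = 1) ->
  Spear V z.
Proof.
move=> ez1; have z1 : rnorm z = 1.
  have [e ext_e ez] := ext_norming z; have e1 := ez1 _ ext_e.
  apply/eqP; rewrite eq_le -{1}ez -{2}e1 -[in X in X && _]e1 ler_reK_norm /=.
  by apply: dual_ball_norm; have [/unit_ball_rnorm] := ext_e.
split=> [|x]; first exact/rnorm1P.
apply: sup_rot_intro => // d d0.
have [e ext_e ex] := ext_norming x; have [/unit_ball_rnorm e1 _] := ext_e.
have [w w1] := rotate (e z); rewrite ez1// ofR1 => wez.
exists w^-1; first exact: unit_scalarsV.
rewrite -[leRHS](rnormZ_unit _ w1) scalerDr scalerA.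
rewrite divff ?unit_scalars_neq0// scale1r.
have := dual_ball (w *: z + x) e1.
by rewrite reK_dualD dualZ wez ex reK1; lra.
Qed.

End spear_vectors.

(** * Points of the ball at which a spear functional is nearly 1 *)

Section spear_functionals.
Context {X : normedModType K}.
Implicit Types (f g : dual X) (x y : X) (b c e : R).

(** Closeness of f x to 1 is measured in [K], not on real parts, so that it survives multiplication
    by a unimodular scalar. *)
Definition near1 f b : set X :=
  [set x | rnorm x <= 1 /\ rnorm (f x - 1 : K^o) <= b].

Lemma near1_convex f b : @convex_set K X (near1 f b).
Proof.
apply/convex_setP => x y t [x1 fx] [y1 fy] /andP[t0 t1].
have s0 : 0 <= 1 - t by rewrite subr_ge0.
split.
  rewrite (le_trans (ler_rnormD _ _))// !rnormZofR !ger0_norm//; nra.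
have -> : f (ofR k t *: x + ofR k (1 - t) *: y) - 1 =
    ofR k t *: (f x - 1) + ofR k (1 - t) *: (f y - 1) :> K^o.
  rewrite linearD !linearZ /= !scalerBr addrACA; congr (_ + _).
  by rewrite -opprD -scalerDl -ofRD subrKC ofR1 scale1r.
rewrite (le_trans (ler_rnormD _ _))// !rnormZofR !ger0_norm//; nra.
Qed.

(** Where f + w g nearly attains 1 + ||g||, both summands are nearly maximal; rotating the point by
    u makes the value of f real. *)
Lemma spear_near1 f g e : Spear (dual X) f -> 0 < e ->
  exists w x, [/\ unit_scalars K w, near1 f e x & rnorm g - e < reK (g (w *: x))].
Proof.
move=> [/rnorm1P f1 sf] e0; have [w w1] := sup_rot_gt (sf g) e0.
move=> /dual_rnorm_gt[x x1]; rewrite blopDE blopZE reKD => fgx.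
have [u u1 ufx] := rotate (f x); have u0 := unit_scalars_neq0 u1.
exists (w * u^-1), (u *: x); split.
- by apply: unit_scalarsM => //; exact: unit_scalarsV.
- split; first by rewrite rnormZ_unit.
  rewrite dualZ ufx -ofR1 -ofRB rnorm_ofR.
  have := dual_ball_norm x (_ : rnorm f <= 1); rewrite f1 lexx => /(_ isT) fx.
  have wgx : reK (w * g x) <= rnorm g.
    rewrite (le_trans (ler_reK_norm _))// [rnorm _]rnormZ_unit//.
    by rewrite (le_trans (dualE _ _))// ler_piMr// rnorm_ge0.
  have := ler_reK_norm (f x).
  rewrite ler0_norm; last by lra.
  by move: fgx; rewrite -[w *: _]/(w * _); lra.
- rewrite scalerA mulrVK ?unitfE// dualZ.
  have fx : reK (f x) <= 1.
    by rewrite (le_trans (dual_ball _ _))// f1.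
  by move: fgx; rewrite -[w *: _]/(w * _); lra.
Qed.

(** A point x0 far from the hull is separated from it by some g with Re g (w x) <= ||g|| - e for all
    w and all x in [near1 f b], against [spear_near1]. *)
Lemma spear_aconv_near1 f b : Spear (dual X) f -> 0 < b ->
  unit_ball X `<=` closure (aconv (near1 f b)).
Proof.
move=> sf b0 x0 /unit_ball_rnorm x01; apply/closure_rnormP => e e0.
apply: contrapT => /forall2NP far.
pose C := [set x0 - a | a in aconv (near1 f b)].
have sub w x : unit_scalars K w -> near1 f b x -> aconv (near1 f b) (w *: x).
  by move=> w1 fx; apply: sub_conv_hull; exists w => //; exists x.
have [||||g g1 gC] := @separation R k X C e.
- have [w [x [w1 fx _]]] := spear_near1 0 sf b0.
  by exists (x0 - w *: x), (w *: x) => //; exact: sub.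
- apply/convex_setP => _ _ t [a aA <-] [a' aA' <-] t01.
  exists (ofR k t *: a + ofR k (1 - t) *: a').
    by apply: (convex_setP _).1; first exact: conv_hull_convex.
  rewrite !scalerBr addrACA -opprD -scalerDl -ofRD subrKC ofR1 scale1r.
  by [].
- exact: ltW.
- move=> _ [a aA <-]; have [|/negP] := far a; first by [].
  by rewrite -leNgt.
have m0 : 0 < Num.min b e by rewrite lt_min b0.
have [w [x [w1 [x1 fx] gx]]] := spear_near1 g sf m0.
have mb : Num.min b e <= b by rewrite ge_min lexx.
have me : Num.min b e <= e by rewrite ge_min lexx orbT.
have /gC : C (x0 - w *: x).
  by exists (w *: x) => //; apply: sub => //; split=> //; exact: le_trans mb.
rewrite reK_dualB => h.
have := ler_dual g x0.
have : rnorm g * rnorm x0 <= rnorm g by rewrite ler_piMr// rnorm_ge0.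
lra.
Qed.

(* A convex combination of rotations [w x] of points of a slice on which f is
   nearly 1 has most weight on w near 1. The bound is affine in f z, by
   [|1 - w| <= c + |1 - w|^2 / (4 c)], hence stable under convex combinations. *)
Lemma aconv_near1 f b c z : rnorm f <= 1 -> 0 < c -> aconv (near1 f b) z ->
  exists2 x, near1 f b x & rnorm (z - x) <= c + (1 - reK (f z) + b) / (2 * c).
Proof.
move=> f1 c0; move: z.
pose W := [set z | exists2 x, near1 f b x &
  rnorm (z - x) <= c + (1 - reK (f z) + b) / (2 * c)].
have lf := dual_real_linear f.
apply: (@conv_hull_sub _ _ _ _ W) => [|_ [w w1 [x fx <-]]].
  apply/convex_setP => z1 z2 t [x1 fx1 zx1] [x2 fx2 zx2] t01.
  exists (ofR k t *: x1 + ofR k (1 - t) *: x2).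
    by apply: (convex_setP _).1 => //; exact: near1_convex.
  have [t0 t1] := andP t01; have s0 : 0 <= 1 - t by rewrite subr_ge0.
  rewrite opprD addrACA -!scalerBr (le_trans (ler_rnormD _ _))//.
  rewrite !rnormZofR !ger0_norm// lf.1 !lf.2.
  apply: (@le_trans _ _ (t * (c + (1 - reK (f z1) + b) / (2 * c)) +
    (1 - t) * (c + (1 - reK (f z2) + b) / (2 * c)))).
    by rewrite lerD// ler_wpM2l.
  rewrite le_eqVlt; apply/orP; left; apply/eqP; field.
  by rewrite gt_eqF.
exists x => //; have [x1 fx1] := fx.
have rw : reK (f (w *: x)) - b <= reK w.
  rewrite dualZ.
  have := ler_reK_norm (w * (f x - 1)).
  rewrite [rnorm _]rnormZ_unit// mulrBr mulr1 reKB.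
  lra.
rewrite rnorm_distC -{1}(scale1r x) -scalerBl rnormZ.
rewrite (le_trans (ler_wpM2l (rnorm_ge0 (1 - w : K^o)) x1))// mulr1.
have := unit_scalars_dist w1; set s := rnorm _ => ss.
rewrite -subr_ge0.
have -> : c + (1 - reK (f (w *: x)) + b) / (2 * c) - s =
    (2 * c ^+ 2 + (1 - reK (f (w *: x)) + b) - 2 * s * c) / (2 * c).
  by field; rewrite gt_eqF.
(* The square gives s <= c + s^2 / (4 c), where s^2 = 2 (1 - Re w). *)
have := sqr_ge0 (s - 2 * c); have -> : (s - 2 * c) ^+ 2 =
  s ^+ 2 + 4 * c ^+ 2 - 4 * (s * c) by ring.
rewrite ss => h; apply: divr_ge0; last by rewrite mulr_ge0// ltW.
by move: h rw; rewrite -mulrA; lra.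
Qed.

(** A point z of the absolutely convex hull of [near1 f b] within c^2 of x satisfies 1 - Re (f z) <=
    2 c^2, so [aconv_near1] moves it by at most c + 3 c^2 / (2 c) into [near1 f b]. *)
Lemma near1_refine f b c x : Spear (dual X) f -> 0 < c <= 1 -> 0 < b <= c ^+ 2 ->
  near1 f (c ^+ 2) x -> exists2 y, near1 f b y & rnorm (x - y) <= 4 * c.
Proof.
move=> sf /andP[c0 c1] /andP[b0 bc] [x1 fx].
have [/rnorm1P f1 _] := sf; have f1' : rnorm f <= 1 by rewrite f1.
have c20 : 0 < c ^+ 2 by rewrite exprn_gt0.
have /unit_ball_rnorm/(spear_aconv_near1 sf b0) := x1.
move=> /closure_rnormP/(_ _ c20)[z az xz].
have [y fy zy] := aconv_near1 f1' c0 az; exists y => //.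
have fz : 1 - reK (f z) <= 2 * c ^+ 2.
  have := ler_norm_reK (f x - 1); rewrite reKB reK1 ler_norml => /andP[h _].
  have := dual_ball (x - z) f1'; rewrite reK_dualB; lra.
have : rnorm (z - y) <= c + 3 * c ^+ 2 / (2 * c).
  rewrite (le_trans zy)// lerD2l ler_pM2r ?invr_gt0 ?mulr_gt0//.
  lra.
have -> : c + 3 * c ^+ 2 / (2 * c) = c * 5 / 2 by field; rewrite gt_eqF.
have := ler_rnorm_dist x z y.
by move: xz; rewrite expr2; nra.
Qed.

End spear_functionals.
End spear.

(** * Completeness: from thin slices to the face *)

Section face.
Context {R : realType} {k : scalar_kind}.
Local Notation K := (scalars R k).

Lemma exists_half_pow (c e : R) : 0 < e -> exists n, c / 2 ^+ n < e.
Proof.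
move=> e0; exists (Num.truncn (c / e)).+1.
rewrite ltr_pdivrMr ?exprn_gt0// mulrC -ltr_pdivrMr//.
apply: (lt_trans (truncnS_gt _)); rewrite -natrX ltr_nat.
exact: ltn_expl.
Qed.

Lemma rnorm_complete (V : completeNormedModType K) (u : nat -> V) (b : nat -> R) :
  (forall n j, rnorm (u n - u (n + j)%N) <= b n) ->
  (forall e : R, 0 < e -> exists n, b n < e) ->
  exists l, forall n, rnorm (u n - l) <= b n.
Proof.
move=> ub b0; have : cvg (u @ \oo).
  apply: cauchy_cvg; apply: cauchy_exP => e e0.
  have re0 : 0 < reK e by rewrite -(ltr_ofR (k := k)) ofR0 reK_ge0// ltW.
  have [n bn] := b0 _ re0; exists (u n), n => // m /= nm.
  rewrite -ball_normE /= -[e]reK_ge0 ?ltW// -rnormE ltr_ofR.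
  by rewrite -(subnKC nm) (le_lt_trans (ub _ _)).
move=> /cvg_ex[l ul]; exists l => n; apply/ler_addgt0Pr => e e0.
have le : nbhs l [set y | rnorm (l - y) < e] by apply/nbhs_rnormP; exists e.
have [m _ hm] := ul _ le.
rewrite (le_trans (ler_rnorm_dist _ (u (n + m)%N) _))// lerD//.
by rewrite rnorm_distC ltW//; apply: hm; rewrite /= leq_addl.
Qed.

(** Iterating [near1_refine] with c / 2^n gives steps of length at most 4 c / 2^n, hence a Cauchy
    sequence whose limit satisfies f y = 1. *)
Lemma near1_attain (X : completeNormedModType K) (f : dual X) (c : R) (x : X) :
  Spear (dual X) f -> 0 < c <= 1 -> near1 f (c ^+ 2) x ->
  exists y, [/\ rnorm y <= 1, f y = 1 :> K & rnorm (x - y) <= 8 * c].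
Proof.
move=> sf /andP[c0 c1] fx; pose b n := c / 2 ^+ n.
have bS n : b n.+1 = b n / 2 by rewrite /b exprSr invfM mulrA.
have b0 n : 0 < b n by rewrite /b divr_gt0// exprn_gt0.
have b1 n : b n <= 1.
  by elim: n => [|n IH]; rewrite ?bS; [rewrite /b expr0 divr1|have := b0 n; lra].
pose next n y := [set z | near1 f (b n.+1 ^+ 2) z /\ rnorm (y - z) <= 4 * b n].
have nextP n y : near1 f (b n ^+ 2) y -> next n y !=set0.
  have h : 0 < b n.+1 ^+ 2 <= b n ^+ 2.
    by rewrite exprn_gt0//= bS; have := b0 n; rewrite !expr2; nra.
  have h' : 0 < b n <= 1 by rewrite b0 b1.
  by move=> fy; have [z fz yz] := near1_refine sf h' h fy; exists z.
pose u := fix u n := if n is n'.+1 then get (next n' (u n')) else x.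
have uP n : near1 f (b n ^+ 2) (u n).
  elim: n => [|n IH]; first by rewrite /b expr0 divr1.
  by have /getPex[] := nextP _ _ IH.
have uS n : rnorm (u n - u n.+1) <= 4 * b n.
  by have /getPex[] := nextP _ _ (uP n).
(* Telescoping: since b halves, 4 b n = 8 b n - 8 b (n + 1). *)
have uj n j : rnorm (u n - u (n + j)%N) <= 8 * b n - 8 * b (n + j)%N.
  elim: j => [|j IH]; first by rewrite addn0 !subrr rnorm0.
  rewrite (le_trans (ler_rnorm_dist _ (u (n + j)%N) _))// addnS.
  by have := uS (n + j)%N; rewrite bS; lra.
have [n j|e e0|l ul] := @rnorm_complete X u (fun n => 8 * b n).
- by rewrite (le_trans (uj n j))// gerBl mulr_ge0// ltW.
- have [n bn] := @exists_half_pow (8 * c) e e0; exists n.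
  by rewrite /b mulrA.
have [/rnorm1P f1 _] := sf.
(* The 9 is 8 for the distance to the limit plus 1 for the defect of u n. *)
have small (r : R) : (forall n, r <= 9 * b n) -> r <= 0.
  move=> rb; rewrite leNgt; apply/negP => r0.
  have [n] := @exists_half_pow (9 * c) r r0; rewrite ltNge -mulrA.
  by rewrite [_ <= _]rb.
exists l; split; last by have := ul 0%N; rewrite /b expr0 divr1.
  rewrite -subr_le0; apply: small => n; have [un1 _] := uP n.
  have := lerB_rnorm l (u n); rewrite rnorm_distC; have := ul n.
  by have := b0 n; lra.
apply/eqP; rewrite -subr_eq0; apply/eqP/(@rnorm_eq0 _ _ K^o)/eqP.
rewrite eq_le rnorm_ge0 andbT; apply: small => n; have [_ fun1] := uP n.
have -> : f l - 1 = f (l - u n) + (f (u n) - 1) :> K^o.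
  by rewrite linearB addrA subrK.
rewrite (le_trans (ler_rnormD _ _))//.
have := dualE f (l - u n); rewrite f1 mul1r rnorm_distC; have := ul n.
have : b n ^+ 2 <= b n by rewrite expr2 ler_piMr// ltW.
lra.
Qed.

(** * Faces, denting points and differentiability of the norm *)

Section dual.
Context {X : normedModType K}.
Implicit Types (f g : dual X) (x : X) (b c e : R).

Lemma has_sup_sphere f : rnorm f = 1 -> unit_sphere X !=set0 ->
  has_sup [set reK (f z) | z in unit_sphere X].
Proof.
move=> f1 [x sx]; split; first by exists (reK (f x)), x.
exists 1 => _ [z /rnorm1P z1 <-]; rewrite -z1; apply: dual_ball.
by rewrite f1.
Qed.

(** Identifies the face of the sphere, for f of norm one, as the points where Re f = 1. *)
Lemma sup_sphere f : rnorm f = 1 ->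
  sup [set reK (f z) | z in unit_sphere X] = 1.
Proof.
move=> f1; have h e : 0 < e -> exists2 z, unit_sphere X z & 1 - e < reK (f z).
  (* The maximum with 0 makes f positive at x, so normalizing x does not decrease its value. *)
  move=> e0; have [|x x1 fx] := @dual_rnorm_gt _ _ _ f (Num.max 0 (1 - e)).
    by rewrite f1 gt_max ltr01; lra.
  move: fx; rewrite gt_max => /andP[fx0 fxe].
  have xn0 : x != 0.
    by apply: contraTneq fx0 => ->; rewrite linear0 reK0 ltxx.
  exists (ofR k (rnorm x)^-1 *: x); first exact/rnorm1P/normalize.
  rewrite dualZ reKZ (lt_le_trans fxe)// ler_peMl ?(ltW fx0)//.
  by rewrite invf_ge1// rnorm_gt0.
have [z0 sz0 _] := h 1 ltr01; have hs := has_sup_sphere f1 (ex_intro _ z0 sz0).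
apply/eqP; rewrite eq_le; apply/andP; split.
  apply: ge_sup; first exact: hs.1.
  by move=> _ [z /rnorm1P z1 <-]; rewrite -z1; apply: dual_ball; rewrite f1.
apply/ler_addgt0Pr => e /h[z sz /ltW fz]; rewrite -lerBlDr (le_trans fz)//.
by apply: ub_le_sup; [exact: hs.2|exists z].
Qed.

(** A functional g nearly attains its norm on the hull of the rotated face, hence at some w y with y
    in the face; there Re (f + w g) y is nearly 1 + ||g||. *)
Lemma face_spear f : rnorm f = 1 ->
  unit_ball X `<=` closure (aconv (Face (unit_sphere X) f)) ->
  Spear (dual X) f.
Proof.
move=> f1 clF; split; first exact/rnorm1P.
move=> g; apply: sup_rot_intro => // e e0.
have e2 : rnorm g - e / 2 < rnorm g by lra.
have [x /unit_ball_rnorm/clF/closure_rnormP xF gx] := dual_rnorm_gt e2.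
have gp : 0 < rnorm g + 1 by rewrite ltr_wpDl// rnorm_ge0.
have [|a aF xa] := xF (e / 2 / (rnorm g + 1)); first by rewrite !divr_gt0.
have ga : rnorm g - e < reK (g a).
  have := ler_dual g (x - a); rewrite reK_dualB.
  have : rnorm g * rnorm (x - a) <= e / 2; last by lra.
  rewrite (@le_trans _ _ ((rnorm g + 1) * rnorm (x - a)))//.
    by rewrite ler_wpM2r ?rnorm_ge0// lerDl.
  by rewrite mulrC -ler_pdivlMr// ltW.
have [w [y [w1 [y1 fy] gy]]] : exists w y, [/\ unit_scalars K w,
    Face (unit_sphere X) f y & rnorm g - e < reK (g (w *: y))].
  apply: contrapT => nwy; move: ga; apply/negP; rewrite -leNgt.
  apply: (aconv_half (dual_real_linear g) _ aF) => w y w1 Fy.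
  by rewrite leNgt; apply/negP => gwy; apply: nwy; exists w, y.
exists w => //; have := ler_dual (f + w *: g) y; rewrite (rnorm1P y).1// mulr1.
apply: le_trans; rewrite blopDE blopZE reKD fy sup_sphere//.
by move: gy; rewrite dualZ -[w *: _]/(w * _); lra.
Qed.

Lemma sup_ball (x : X) :
  sup [set reK (blop_fun g x) | g in unit_ball (dual X)] = rnorm x.
Proof.
have [f f1 fx] := norming x.
have ubx : ubound [set reK (blop_fun g x) | g in unit_ball (dual X)] (rnorm x).
  by move=> _ [g /unit_ball_rnorm g1 <-]; exact: dual_ball.
have fS : [set reK (blop_fun g x) | g in unit_ball (dual X)] (rnorm x).
  by exists f => //; exact/unit_ball_rnorm.
apply/eqP; rewrite eq_le; apply/andP; split.
  by apply: ge_sup => //; exists (rnorm x).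
by apply: ub_le_sup => //; exists (rnorm x).
Qed.

Lemma wsliceP x (a : R) f :
  wslice x a f <-> rnorm f <= 1 /\ rnorm x - a < reK (f x).
Proof. by rewrite /wslice /= sup_ball; split=> -[/unit_ball_rnorm]. Qed.

(** If f = t g + (1 - t) h, each slice containing f contains g or h. Its distance to f is a fixed
    multiple of ||g - h||, so small slices force g = h. *)
Lemma wdenting_ext f : wdenting X f -> ext (unit_ball (dual X)) f.
Proof.
move=> [fB df]; split=> // g h t gB hB t01 fgh; have [t0 t1] := andP t01.
have f1 := (unit_ball_rnorm f).1 fB.
have s0 : 0 < 1 - t by rewrite subr_gt0.
have fg : f - g = ofR k (1 - t) *: (h - g).
  rewrite fgh scalerBr addrAC [RHS]addrC; congr (_ + _).
  by rewrite -{2}(scale1r g) -scalerBl -scaleNr -ofR1 -ofRB -ofRN opprB.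
have fh : f - h = ofR k t *: (g - h).
  rewrite fgh scalerBr -addrA; congr (_ + _).
  rewrite -{2}(scale1r h) -scalerBl -scaleNr -ofR1 -ofRB -ofRN.
  by congr (ofR k _ *: _); ring.
have gh0 : rnorm (g - h) <= 0.
  apply/ler_addgt0Pr => e e0; rewrite add0r.
  have m0 : 0 < Num.min t (1 - t) by rewrite lt_min t0.
  have [|x [a [a0 fS dS]]] := df (e * Num.min t (1 - t)); first exact: mulr_gt0.
  have [_ fx] := (wsliceP x a f).1 fS.
  have fxE : reK (f x) = t * reK (g x) + (1 - t) * reK (h x).
    by rewrite fgh -!reKZ -reKD.
  have [gx|hx] : rnorm x - a < reK (g x) \/ rnorm x - a < reK (h x).
  - have [gx|gx] := ltP (rnorm x - a) (reK (g x)); first by left.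
    right; rewrite ltNge; apply/negP => hx; move: fx; rewrite fxE.
    by apply/negP; rewrite -leNgt; nra.
  - have /(dS _ _ fS) : wslice x a g.
      by apply/wsliceP; split=> //; exact/unit_ball_rnorm.
    rewrite fg rnormZofR gtr0_norm// rnorm_distC => h1.
    have : Num.min t (1 - t) <= 1 - t by rewrite ge_min lexx orbT.
    by have := rnorm_ge0 (g - h); nra.
  - have /(dS _ _ fS) : wslice x a h.
      by apply/wsliceP; split=> //; exact/unit_ball_rnorm.
    rewrite fh rnormZofR gtr0_norm// => h1.
    have : Num.min t (1 - t) <= t by rewrite ge_min lexx.
    by have := rnorm_ge0 (g - h); nra.
have /rnorm_eq0/eqP : rnorm (g - h) = 0.
  by apply/eqP; rewrite eq_le gh0 rnorm_ge0.
rewrite subr_eq0 => /eqP gh; have fh' : f = h.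
  by apply/eqP; rewrite -subr_eq0 fh gh subrr scaler0.
by rewrite fh' gh.
Qed.

(* Smulyan's criterion: f is the derivative of the norm at x. *)
Lemma frechet_wdenting (x : X) :
  frechet_differentiable (@rnorm R k X) x ->
  exists2 f, wdenting X f & reK (f x) = rnorm x.
Proof.
move=> [D [linD _ frD]].
have D0 : D 0 = 0.
  by have := linD 1 0 0; rewrite ofR1 scale1r addr0 mul1r; lra.
have lD : real_linear D.
  split=> [u v|r u]; first by have := linD 1 u v; rewrite ofR1 scale1r mul1r.
  by have := linD r u 0; rewrite !addr0 D0 addr0.
have fr e h : 0 < e -> exists2 t : R, 0 < t &
    `|rnorm (x + ofR k t *: h) - rnorm x - t * D h| <= t * (e * rnorm h).
  move=> e0; have [d d0 dh] := frD e e0.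
  have h1 : 0 < rnorm h + 1 by rewrite ltr_wpDl// rnorm_ge0.
  have t0 : 0 < d / (rnorm h + 1) by exact: divr_gt0.
  exists (d / (rnorm h + 1)) => //; rewrite -lD.2 mulrCA.
  rewrite -{3}(gtr0_norm t0) -(rnormZofR (k := k)); apply: dh.
  rewrite rnormZofR gtr0_norm// -mulrA -[ltRHS]mulr1 ltr_pM2l//.
  by rewrite mulrC ltr_pdivrMr// mul1r ltrDl.
have De e h : 0 < e -> D h <= rnorm h + e * rnorm h.
  move=> e0; have [t t0] := fr e h e0; rewrite ler_norml => /andP[h1 _].
  have := lerB_rnorm (x + ofR k t *: h) x.
  rewrite addrAC subrr add0r rnormZofR gtr0_norm// => h2.
  by rewrite -(ler_pM2l t0); lra.
have D1 h : D h <= 1 * rnorm h.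
  rewrite mul1r; apply/ler_addgt0Pr => e e0.
  have h1 : 0 < rnorm h + 1 by rewrite ltr_wpDl// rnorm_ge0.
  apply: (le_trans (De (e / (rnorm h + 1)) h _)); first exact: divr_gt0.
  rewrite lerD2l mulrAC ler_pdivrMr// ler_pM2l// lerDl.
  by [].
have [f f1 fD] := dual_of_real ler01 lD D1.
(* In the direction x itself the norm grows linearly, with slope ||x||. *)
have fx : reK (f x) = rnorm x.
  apply/eqP; rewrite eq_le dual_ball//= fD; apply/ler_addgt0Pr => e e0.
  have h1 : 0 < rnorm x + 1 by rewrite ltr_wpDl// rnorm_ge0.
  have e1 : 0 < e / (rnorm x + 1) by exact: divr_gt0.
  have [t t0] := fr _ x e1; rewrite ler_norml => /andP[_].
  have t1 : 0 < 1 + t by lra.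
  rewrite -{1}(scale1r x) -ofR1 -scalerDl -ofRD rnormZofR gtr0_norm//.
  have : e / (rnorm x + 1) * rnorm x <= e.
    by rewrite mulrAC ler_pdivrMr// ler_pM2l// lerDl.
  move=> h2 h3; rewrite -subr_le0 -(pmulr_rle0 _ t0).
  have : t * (e / (rnorm x + 1) * rnorm x) <= t * e by rewrite ler_pM2l.
  by lra.
exists f => //; split; first exact/unit_ball_rnorm.
move=> e e0; have e4 : 0 < e / 4 by lra.
have [d d0 dh] := frD _ e4.
have d2 : 0 < d / 2 by lra.
(* Testing g - f on (d / 2) h, the slice and the differentiability estimate each cost e / 4 * (d /
   2), so g is within e / 2 of f. *)
exists x, (e / 4 * (d / 2)); split; first exact: mulr_gt0.
  by apply/wsliceP; split=> //; rewrite fx ltrBlDr ltrDl mulr_gt0.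
have near g : wslice x (e / 4 * (d / 2)) g -> rnorm (g - f) <= e / 2.
  move=> /wsliceP[g1 gx]; apply: dual_rnorm_le => h h1.
  rewrite [(g - f) h](_ : _ = g h - f h)// reKB fD -(ler_pM2l d2).
  have := dh (ofR k (d / 2) *: h); rewrite rnormZofR gtr0_norm// lD.2.
  have dh1 : d / 2 * rnorm h <= d / 2 by rewrite ler_piMr// ltW.
  rewrite ler_norml => /(_ _)/andP[|_ h2]; first by lra.
  have := dual_ball (x + ofR k (d / 2) *: h) g1.
  rewrite reK_dualD dualZ reKZ.
  have : e / 4 * (d / 2 * rnorm h) <= e / 4 * (d / 2) by rewrite ler_pM2l.
  by lra.
move=> g h /near gf /near hf.
have := ler_rnorm_dist g f h; rewrite (rnorm_distC f).
lra.
Qed.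

End dual.

(** [near1_attain] moves the points of [near1] into the face by at most 8 c, and this estimate
    passes to absolutely convex combinations. *)
Lemma spear_face (X : completeNormedModType K) (f : dual X) :
  Spear (dual X) f ->
  unit_ball X = closure (aconv (Face (unit_sphere X) f)).
Proof.
move=> sf; have [/rnorm1P f1 _] := sf; apply/seteqP; split=> [x xB|x].
  (* Two errors of size 8 c add up to at most e. *)
  apply/closure_rnormP => e e0; pose c := Num.min 1 (e / 16).
  have c0 : 0 < c by rewrite lt_min ltr01 divr_gt0.
  have c1 : 0 < c <= 1 by rewrite c0 ge_min lexx.
  have ce : 16 * c <= e by rewrite mulrC -ler_pdivlMr// ge_min lexx orbT.
  have /closure_rnormP/(_ (8 * c))[|a aA xa] :=
    spear_aconv_near1 sf (exprn_gt0 2 c0) xB.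
    by rewrite mulr_gt0.
  pose W := [set z | exists2 y, aconv (Face (unit_sphere X) f) y &
    rnorm (z - y) <= 8 * c].
  have [y Fy ay] : W a.
    move: a aA {xa}; apply: conv_hull_sub => [|_ [w w1 [y fy <-]]].
      apply/convex_setP => z z' t [y Fy zy] [y' Fy' zy'] t01.
      exists (ofR k t *: y + ofR k (1 - t) *: y').
        by apply: (convex_setP _).1 => //; exact: conv_hull_convex.
      have [t0 t1] := andP t01; have s0 : 0 <= 1 - t by rewrite subr_ge0.
      rewrite opprD addrACA -!scalerBr (le_trans (ler_rnormD _ _))//.
      by rewrite !rnormZofR !ger0_norm//; nra.
    have [z [z1 fz yz]] := near1_attain sf c1 fy.
    exists (w *: z); last by rewrite -scalerBr rnormZ_unit.
    apply: sub_conv_hull; exists w => //; exists z => //; split.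
      apply/rnorm1P/eqP; rewrite eq_le z1 -f1.
      have := dual_ball z (_ : rnorm f <= 1).
      by rewrite f1 lexx fz reK1 => /(_ isT).
    by rewrite sup_sphere// fz reK1.
  exists y => //; have := ler_rnorm_dist x a y.
  lra.
move=> /closure_rnormP xF; apply/unit_ball_rnorm/ler_addgt0Pr => e e0.
have [a aF xa] := xF e e0.
have a1 : rnorm a <= 1.
  apply/unit_ball_rnorm; move: a aF {xa}.
  apply: conv_hull_sub; first exact: unit_ball_convex.
  move=> _ [w w1 [y [/rnorm1P y1 _] <-]]; apply/unit_ball_rnorm.
  by rewrite rnormZ_unit// y1.
have := lerB_rnorm x a; lra.
Qed.

(** The norm is convex and continuous on the whole space, hence Frechet differentiable on a dense
    set. *)
Lemma asplund_norming (Y : completeNormedModType K) : asplund Y ->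
  forall (y : Y) (e : R), 0 < e -> exists (y' : Y) (f : dual Y),
    [/\ rnorm (y - y') < e, wdenting Y f & reK (f y') = rnorm y'].
Proof.
move=> aY y e e0.
have [||||x _|D [_ _ cD frD]] := aY setT (@rnorm R k Y).
- exact: openT.
- by exists 0.
- by apply/convex_setP.
- move=> x x' t _ _ /andP[t0 t1].
  rewrite (le_trans (ler_rnormD _ _))// !rnormZofR !ger0_norm//.
  by rewrite subr_ge0.
- apply/cvgrPdist_lt => d d0.
  apply: (@filterS _ (nbhs x) _ [set z | rnorm (x - z) < d]); last first.
    by apply/nbhs_rnormP; exists d.
  move=> z /=; apply: le_lt_trans; rewrite ler_norml lerB_rnorm andbT.
  by rewrite lerNl opprB rnorm_distC lerB_rnorm.
have /closure_rnormP/(_ e e0)[y' Dy' yy'] := cD y I.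
by have [f df fy'] := frechet_wdenting (frD _ Dy'); exists y', f.
Qed.

End face.

(** * Lushness, spear operators and the alternative Daugavet property *)

Section operators.
Context {R : realType} {k : scalar_kind}.
Local Notation K := (scalars R k).

Section normed.
Context {X Y : normedModType K}.
Implicit Types (G T : blop X Y) (f : dual Y) (g : dual X).

Lemma blop_rnorm_gt T (r : R) : r < rnorm T ->
  exists2 x, rnorm x <= 1 & r < rnorm (T x).
Proof.
move=> rT; apply: contrapT => /forall2NP nx.
move: rT; apply/negP; rewrite -leNgt /rnorm blop_normE ofRK.
by apply: opnorm_le => x x1; have [//|/negP] := nx x; rewrite -leNgt.
Qed.

Lemma ler_blop T x : rnorm x <= 1 -> rnorm (T x) <= rnorm T.
Proof. by move=> x1; rewrite [leRHS]/rnorm blop_normE ofRK ler_opnorm. Qed.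

Lemma adjoint_ball G f : rnorm G = 1 -> rnorm f <= 1 -> rnorm (adjoint G f) <= 1.
Proof.
move=> G1 f1; apply: dual_rnorm_le => x x1.
by rewrite (le_trans (dual_ball (G x) f1))// (le_trans (ler_blop G x1))// G1.
Qed.

(** Lushness is used at an x0 nearly norming T and at y = T x0 / ||T x0||. Separating G (conv F) + y
    from 0 gives one f nearly 1 at y and on G F; f T is nearly ||T|| at x0, hence at some w x with x
    in F. *)
Lemma lush_spear_operator G : lush G -> spear_operator G.
Proof.
move=> [/rnorm1P G1 lG]; split=> [|T]; first exact/rnorm1P.
apply: sup_rot_intro => // e e0.
have [T0|T0] := eqVneq T 0.
  exists 1; first exact: unit_scalars1.
  by rewrite T0 scaler0 addr0 rnorm0 G1; lra.
have {}T0 := rnorm_gt0 T0; have T1 : 0 < 1 + 2 * rnorm T by lra.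
have [|x0 x01] := @blop_rnorm_gt T (Num.max 0 (rnorm T - e / 4)).
  by rewrite gt_max T0; lra.
rewrite gt_max => /andP[Tx0 Tx0e].
pose d := Num.min 1 (e / (4 * (1 + 2 * rnorm T))).
have d0 : 0 < d by rewrite lt_min ltr01 divr_gt0// mulr_gt0.
have d1 : d <= 1 by rewrite ge_min lexx.
have dE : d * (1 + 2 * rnorm T) <= e / 4.
  rewrite -ler_pdivlMr// -mulrA -invfM ge_min; apply/orP; right.
  by rewrite lexx.
pose y := ofR k (rnorm (T x0))^-1 *: T x0.
have y1 : rnorm y = 1.
  by rewrite rnormZofR gtr0_norm ?invr_gt0// mulVf// gt_eqF.
have TxE : T x0 = ofR k (rnorm (T x0)) *: y.
  by rewrite scalerA -ofRM mulfV ?gt_eqF// ofR1 scale1r.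
have [F [FB FG [z zF x0z]]] :=
  lG x0 d y ((unit_ball_rnorm _).2 x01) d0 ((rnorm1P _).2 y1).
have F0 : F !=set0.
  apply/set0P/negP => /eqP F0; suff : set0 z by [].
  apply: conv_hull_sub zF; first by apply/convex_setP.
  by move=> t [w _ [x]]; rewrite F0.
pose C := [set G x + y | x in conv_hull F].
have [||||f f1 fC] := @separation R k Y C (2 - d).
- by have [x Fx] := F0; exists (G x + y), x => //; exact: sub_conv_hull.
- apply/convex_setP => _ _ t [a aF <-] [b bF <-] t01.
  exists (ofR k t *: a + ofR k (1 - t) *: b).
    by apply: (convex_setP _).1 => //; exact: conv_hull_convex.
  rewrite linearD !linearZ !scalerDr addrACA -scalerDl -ofRD subrKC ofR1.
  by rewrite scale1r.
- by lra.
- by move=> _ [x /FG[_ /ltW] Gx <-].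
have fy1 : reK (f y) <= 1 by rewrite (le_trans (dual_ball y f1)) ?y1.
have fG x : F x -> 2 - d <= reK (f (G x)) + reK (f y).
  move=> Fx; rewrite -reK_dualD; apply: fC; exists x => //.
  exact: sub_conv_hull.
have fy : 1 - d <= reK (f y).
  have [x Fx] := F0; have := FB x Fx => /unit_ball_rnorm x1.
  have := dual_ball (G x) f1; have := ler_blop G x1; have := fG x Fx.
  by rewrite G1; lra.
have fTz : rnorm T - e / 2 < reK (adjoint T f z).
  have -> : reK (adjoint T f z) = reK (f (T x0)) - reK (f (T (x0 - z))).
    by rewrite -reK_dualB -linearB opprB addrC subrK.
  have fTx0 : reK (f (T x0)) = rnorm (T x0) * reK (f y).
    by rewrite {1}TxE dualZ reKZ.
  have : reK (f (T (x0 - z))) <= rnorm T * d.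
    rewrite (le_trans (dual_ball _ f1))// (le_trans (ler_rnorm_blop _ _))//.
    by rewrite ler_wpM2l ?rnorm_ge0// ltW.
  have : rnorm (T x0) * (1 - d) <= rnorm (T x0) * reK (f y).
    by rewrite ler_wpM2l ?rnorm_ge0.
  have : rnorm (T x0) * d <= rnorm T * d by rewrite ler_pM2r// ler_blop.
  by rewrite fTx0; lra.
have [w [x [w1 Fx fTx]]] : exists w x, [/\ unit_scalars K w, F x &
    rnorm T - e / 2 < reK (adjoint T f (w *: x))].
  apply: contrapT => nwx; move: fTz; apply/negP; rewrite -leNgt.
  apply: (aconv_half (dual_real_linear (adjoint T f)) _ zF) => w x w1 Fx.
  by rewrite leNgt; apply/negP => h; apply: nwx; exists w, x.
exists w => //; have /unit_ball_rnorm x1 := FB x Fx.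
have := ler_blop (G + w *: T) x1; have := dual_ball ((G + w *: T) x) f1.
rewrite blopDE blopZE reK_dualD; have := fG x Fx.
have TwE : adjoint T f (w *: x) = f (w *: T x) by rewrite /= linearZ.
move: fTx; rewrite TwE.
have : d <= e / 4.
  by rewrite (le_trans _ dE)// ler_peMr ?(ltW d0)//; lra.
by lra.
Qed.


Lemma spear_operator_adp G : spear_operator G -> alternative_daugavet G.
Proof. by move=> [G1 sG]; split=> // T _; exact: sG. Qed.

Lemma exists_rank_one g (y : Y) : exists T : blop X Y, forall x, T x = g x *: y.
Proof.
have TP : (fun x => g x *: y) \in @bounded_linear R k X Y.
  apply/asboolP; split=> [a u v|].
    by rewrite linearP scalerDl scalerA.
  exists (rnorm g * rnorm y) => x; rewrite rnormZ mulrAC.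
  by rewrite ler_wpM2r ?rnorm_ge0// dualE.
by exists (BLOp TP).
Qed.

(** If h nearly norms G + w T, where T = g (.) y, then |h y| is nearly 1. A rotation u h then lies
    in the small slice defined by y, so it may be replaced by f. *)
Lemma adp_wdenting G f : alternative_daugavet G -> wdenting Y f ->
  Spear (dual X) (adjoint G f).
Proof.
move=> [/rnorm1P G1 adp] [/unit_ball_rnorm f1 df].
have [x0 x0n0] : exists x0 : X, x0 != 0.
  have [|x x1 Gx] := @blop_rnorm_gt G 0; first by rewrite G1.
  exists x; apply: contraTneq Gx => ->.
  by rewrite linear0 rnorm0 ltxx.
have [y0 y00] : exists y0 : Y, rnorm y0 = 1.
  have [|x x1 Gx] := @blop_rnorm_gt G 0; first by rewrite G1.
  exists (ofR k (rnorm (G x))^-1 *: G x); apply: normalize.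
  by apply: contraTneq Gx => ->; rewrite rnorm0 ltxx.
have slice e : 0 < e -> exists (y : Y) (a : R), [/\ rnorm y = 1, 0 < a &
    forall h : dual Y, rnorm h <= 1 -> 1 - a < reK (h y) -> rnorm (h - f) <= e].
  move=> e0; have [y [a [a0 /wsliceP[_ fy] dS]]] := df e e0.
  have fS : wslice y a f by apply/wsliceP.
  (* The slice defined by 0 is the whole ball, so any unit vector will do instead. *)
  have [y0'|yn0] := eqVneq y 0.
    exists y0, a; split=> // h h1 _; apply: dS => //; apply/wsliceP.
    by split=> //; rewrite y0' rnorm0 linear0 reK0; lra.
  have yg0 := rnorm_gt0 yn0.
  exists (ofR k (rnorm y)^-1 *: y), (a / rnorm y); split.
  - exact: normalize.
  - exact: divr_gt0.
  - move=> h h1; rewrite dualZ reKZ => hy; apply: dS => //; apply/wsliceP.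
    split=> //; move: hy; rewrite -(ltr_pM2l yg0) mulrBr mulr1.
    rewrite (mulrCA _ a) divff ?gt_eqF// mulr1.
    by rewrite mulrA divff ?gt_eqF// mul1r.
have key g e : g != 0 -> 0 < e -> exists2 w, unit_scalars K w &
    1 + rnorm g - e <= rnorm (adjoint G f + w *: g).
  move=> gn0 e0; have g0 := rnorm_gt0 gn0.
  have e3 : 0 < e / 3 by lra.
  have [y [a [y1 a0 ya]]] := slice _ e3.
  have [T TE] := exists_rank_one g y.
  have rT : rank_one T.
    exists y.
      by apply: contraTneq (oner_neq0 R) => y0'; rewrite -y1 y0' rnorm0 eqxx.
    have [x x1 gx] := dual_rnorm_gt g0.
    have gx0 : g x != 0 :> K by apply: contraTneq gx => ->; rewrite reK0 ltxx.
    apply/seteqP; split=> [_ [u _ <-]|_ [b _ <-]]; first by exists (g u).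
    exists ((b / g x) *: x) => //; rewrite TE dualZ divfK//.
  have Tg : rnorm g <= rnorm T.
    apply: dual_rnorm_le => x x1; rewrite (le_trans (ler_reK_norm _))//.
    by rewrite (le_trans _ (ler_blop T x1))// TE rnormZ y1 mulr1.
  (* The bound e / 3 is a share of the final error; a ||g|| / 2 forces u h into the slice. *)
  pose d := Num.min (e / 3) (a * rnorm g / 2).
  have d0 : 0 < d by rewrite lt_min e3 divr_gt0// mulr_gt0.
  have de : d <= e / 3 by rewrite ge_min lexx.
  have da : d <= a * rnorm g / 2 by rewrite ge_min lexx orbT.
  have [w w1 GT] := sup_rot_gt (adp T rT) d0.
  have [x x1 GTx] := blop_rnorm_gt GT.
  have [h h1 hE] := norming ((G + w *: T) x).
  move: GTx; rewrite -hE blopDE blopZE TE reK_dualD scalerA dualZ => hGT.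
  have [u u1 uh] := rotate (h y).
  set r := rnorm (h y : K^o) in uh.
  have r1 : r <= 1 by rewrite -y1; exact: dual_ball_norm.
  have hG : reK (h (G x)) <= 1.
    by rewrite (le_trans (dual_ball _ h1))// (le_trans (ler_blop _ x1))// G1.
  have gx1 : rnorm (g x : K^o) <= rnorm g.
    by rewrite (le_trans (dualE _ _))// ler_piMr// rnorm_ge0.
  have wghr : reK (w * g x * h y) <= rnorm (g x : K^o) * r.
    rewrite (le_trans (ler_reK_norm _))// [rnorm _](rnormZ (V := K^o)).
    by rewrite [reK _](rnormZ_unit (V := K^o)).
  have gr : rnorm g * (1 - r) <= d.
    have : rnorm (g x : K^o) * r <= rnorm g * r by rewrite ler_wpM2r ?rnorm_ge0.
    by lra.
  have uh1 : rnorm (u *: h) <= 1 by rewrite rnormZ_unit.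
  have /(ya _ uh1) uhf : 1 - a < reK ((u *: h) y).
    rewrite blopZE [u *: _]uh ofRK ltrBlDr -ltrBlDl -(ltr_pM2l g0).
    by rewrite (le_lt_trans gr)// (le_lt_trans da)// (mulrC (rnorm g)); nra.
  exists w => //.
  apply: (@le_trans _ _ (rnorm ((adjoint G f + w *: g) x : K^o))); last first.
    by rewrite (le_trans (dualE _ _))// ler_piMr// rnorm_ge0.
  (* The main term has modulus above 1 + ||g|| - e / 3; replacing u h by f and u (h y) by 1 costs e
     / 3 each. *)
  have -> : (adjoint G f + w *: g) x =
      u * (h (G x) + w * g x * h y) -
      ((u *: h - f) (G x) - w * g x * (1 - ofR k r)) :> K.
    have -> : (adjoint G f + w *: g) x = f (G x) + w * g x :> K by [].
    have -> : (u *: h - f) (G x) = u * h (G x) - f (G x) :> K by [].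
    by rewrite -uh; ring.
  set s := h (G x) + _; set p := (u *: h - f) (G x); set q := w * g x * _.
  have p1 : rnorm (p : K^o) <= e / 3.
    rewrite (le_trans (dualE _ _))// (le_trans _ uhf)// ler_piMr ?rnorm_ge0//.
    by rewrite -G1 ler_blop.
  have q1 : rnorm (q : K^o) <= e / 3.
    rewrite /q -ofR1 -ofRB [rnorm _](rnormZ (V := K^o)).
    rewrite [reK _](rnormZ_unit (V := K^o))// rnorm_ofR ger0_norm ?subr_ge0//.
    rewrite (le_trans _ de)// (le_trans _ gr)// ler_wpM2r// subr_ge0.
    by [].
  have us : rnorm (u * s : K^o) = rnorm (s : K^o).
    exact: (rnormZ_unit (V := K^o)).
  have := @lerB_rnorm _ _ K^o (u * s) (p - q).
  have := @ler_rnormB _ _ K^o p q; have := ler_reK_norm s.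
  by rewrite us [reK s]reKD; lra.
(* The triangle inequality in [key], for any nonzero g, bounds the norm below by 1 - e. *)
have z1 : rnorm (adjoint G f) = 1.
  apply/eqP; rewrite eq_le adjoint_ball//=; apply/ler_addgt0Pr => e e0.
  have [g g1 gx0] := norming x0.
  have gn0 : g != 0.
    apply: contraTneq (rnorm_gt0 x0n0) => g0.
    by rewrite -gx0 g0 [_ x0](_ : _ = 0)// reK0 ltxx.
  have [w w1 h] := key g e gn0 e0.
  have := ler_rnormD (adjoint G f) (w *: g); rewrite rnormZ_unit//.
  by lra.
split; first exact/rnorm1P.
move=> g; apply: sup_rot_intro => // e e0; have [->|gn0] := eqVneq g 0.
  exists 1; first exact: unit_scalars1.
  by rewrite scaler0 addr0 rnorm0 z1; lra.
exact: key.
Qed.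

End normed.
End operators.

(** * Weak*-density and the cycle of implications *)

(** Approximating the vector y of a slice around e by a y' normed by a denting point puts that point
    in the slice. *)
Lemma wdenting_dense (R : realType) (k : scalar_kind)
    (Y : completeNormedModType (scalars R k)) : asplund Y ->
  ext (unit_ball (dual Y)) `<=` wclosure (wdenting Y).
Proof.
move=> aY e ext_e A eA; have [y [d [d0 dA]]] := choquet ext_e eA.
have d3 : 0 < d / 3 by lra.
have [y' [f [yy' df fy']]] := asplund_norming aY y d3.
exists f; split => //; have [/unit_ball_rnorm f1 _] := df; apply: dA => //.
have [/unit_ball_rnorm e1 _] := ext_e.
have := dual_ball y e1; have := lerB_rnorm y y'.
have := dual_ball (y' - y) f1; rewrite reK_dualB fy'; have := rnorm_distC y y'.
lra.
Qed.

(** By the bipolar theorem it suffices nearly to norm each y by an element of D, and D approximates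
    an extreme functional norming y. *)
Lemma wclosure_spear_ball (R : realType) (k : scalar_kind)
    (X Y : normedModType (scalars R k)) (G : blop X Y) (D : set (dual Y)) :
  rnorm G = 1 -> wdense_in D (ext (unit_ball (dual Y))) ->
  (forall y, D y -> Spear (dual X) (adjoint G y)) ->
  unit_ball (dual Y) = wclosure (conv_hull
    [set y : dual Y | unit_ball (dual Y) y /\ Spear (dual X) (adjoint G y)]).
Proof.
move=> G1 [DE ED] sD; set A := [set _ | _].
have AB : A `<=` unit_ball (dual Y) by move=> f [].
apply/seteqP; split=> [f /unit_ball_rnorm f1|]; last first.
  apply: wclosure_ball; apply: conv_hull_sub => //; exact: unit_ball_convex.
apply: bipolar => [|y e e0]; first exact: conv_hull_convex.
have [h ext_h hy] := ext_norming y.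
have [g [Dg /= gh]] := ED _ ext_h _ (weak_star_nbhs h y e0).
exists g.
  by apply: sub_conv_hull; split; [have [] := DE _ Dg|exact: sD].
have := dual_ball y f1; move: gh; rewrite ltr_norml hy => /andP[]; lra.
Qed.

(** Some h in the generating set has Re h y > 1 - e / 2. The convex set of points where G^* h is
    within e / 4 of 1 serves as F, and h itself bounds the norm of G x + y from below. *)
Lemma wclosure_spear_lush (R : realType) (k : scalar_kind)
    (X Y : normedModType (scalars R k)) (G : blop X Y) : rnorm G = 1 ->
  unit_ball (dual Y) `<=` wclosure (conv_hull
    [set y : dual Y | unit_ball (dual Y) y /\ Spear (dual X) (adjoint G y)]) ->
  lush G.
Proof.
move=> G1 BA; split=> [|x0 e y x01 e0 /rnorm1P y1]; first exact/rnorm1P.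
have [f f1 fy] := norming y; have e2 : 0 < e / 2 by lra.
have [g [gA /= gf]] := BA f ((unit_ball_rnorm f).2 f1) _ (weak_star_nbhs f y e2).
have {gf} gy : 1 - e / 2 < reK (g y).
  by move: gf; rewrite fy y1 ltr_norml => /andP[]; lra.
have [h [/unit_ball_rnorm h1 sh] hy] : exists2 h : dual Y,
    unit_ball (dual Y) h /\ Spear (dual X) (adjoint G h) & 1 - e / 2 < reK (h y).
  apply: contrapT => /forall2NP nh; move: gy; apply/negP; rewrite -leNgt.
  have lu : real_linear (fun h : dual Y => reK (h y)).
    by split=> [h h'|r h]; rewrite ?reKD ?reKZ.
  apply: (conv_hull_half lu _ gA) => h Ah.
  by rewrite leNgt; apply/negP => hy; have [|] := nh h.
have e4 : 0 < e / 4 by lra.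
exists (near1 (adjoint G h) (e / 4)); split=> [x []|x|].
- by move/unit_ball_rnorm.
- move/(conv_hull_sub (@near1_convex _ _ _ (adjoint G h) (e / 4)) (fun _ => id)).
  move=> [x1 hx]; split; first exact/unit_ball_rnorm.
  have := dual_ball (G x + y) h1; rewrite reK_dualD.
  have := ler_norm_reK (h (G x) - 1); rewrite reKB reK1 ler_norml => /andP[+ _].
  have {}hx : rnorm (h (G x) - 1 : (scalars R k)^o) <= e / 4 := hx.
  lra.
- have /closure_rnormP/(_ e e0)[z zF xz] := spear_aconv_near1 sh e4 x01.
  by exists z.
Qed.

Theorem proposition5p3 (R : realType) (k : scalar_kind)
    (X Y : completeNormedModType (scalars R k)) (hY : asplund Y)
    (G : blop X Y) (hG : `|G| = 1) :
  [<-> (* (i) *) lush G;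
       (* (ii) *) spear_operator G;
       (* (iii) *) alternative_daugavet G;
       (* (iv) *)
         forall (x : dual (dual X)) (y : dual Y),
           ext (unit_ball (dual (dual X))) x -> wdenting Y y ->
           `|x (adjoint G y)| = 1;
       (* (v), first form *)
         wdense_in [set y : dual Y | ext (unit_ball (dual Y)) y /\
                                     Spear (dual X) (adjoint G y)]
                   (ext (unit_ball (dual Y)));
       (* (v), second form; Face (unit_sphere X) f does not change when f is
          multiplied by a positive real and is all of the sphere when f = 0,
          so the norm of adjoint G y has to be fixed *)
         exists2 D : set (dual Y), wdense_in D (ext (unit_ball (dual Y))) &
           forall y, D y -> `|adjoint G y| = 1 /\
             unit_ball X = closure (aconv (Face (unit_sphere X) (adjoint G y)));
       (* (vi) *)
         unit_ball (dual Y) =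
         wclosure (conv_hull [set y : dual Y | unit_ball (dual Y) y /\
                                          Spear (dual X) (adjoint G y)])].
Proof.
have /rnorm1P G1 := hG; tfae.
- exact: lush_spear_operator.
- exact: spear_operator_adp.
- move=> adp x y ext_x dy; apply/(@rnorm1P _ _ (scalars R k)^o).
  exact: spear_ext (adp_wdenting adp dy) _ ext_x.
(* The weak*-denting points already form a dense subset: they are extreme, and their images are
   spears by [ext_spear] in the dual of X. *)
- move=> h; split=> [f []//|e ext_e A eA].
  have [f [df Af]] := wdenting_dense hY ext_e eA; exists f; split=> //; split.
    exact: wdenting_ext.
  apply: ext_spear => x ext_x; apply/(@rnorm1P _ _ (scalars R k)^o).
  exact: h.
- move=> dense; eexists; first exact: dense.
  move=> y [_ sy]; split; first by case: sy.
  exact: spear_face.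
- move=> [D dense DF]; apply: wclosure_spear_ball dense _ => // y Dy.
  have [/rnorm1P y1 yF] := DF y Dy; apply: face_spear => //.
  by rewrite -yF.
- by move=> BA; apply: wclosure_spear_lush => //; rewrite -BA.
Qed.
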